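(* Let $T\ge1$, $\nu>0$, $\ell>0$, $\sigma_u>0$, $\sigma_x>0$. Let $\mathcal{U}$ be a Gaussian process on $\mathbb{R}^T\times\mathbb{R}^T$ with stationary isotropic Mat\'ern covariance $k_u([x,y],[v,w])=\sigma_u^2\,h_{\mathrm{Mat}}(\|[x-v,y-w]\|_2;\ell,\nu)$, let $\mathcal{F}(x,y)=\mathcal{U}(x,y)-\mathcal{U}(y,x)$ with $\mathbb{E}[\mathcal{F}(x,y)]=0$ for all $x,y$, and let the attributes be i.i.d. Gaussian with covariance $\sigma_x^2I$, drawn independently of $\mathcal{F}$. With $r=\sigma_x/\ell$, the shared-endpoint correlation is $$\rho(r,\nu)=\frac{\mathbb{E}\left[(1+2r^2V)^{-T/2}\right]-\mathbb{E}\left[(1+r^2V)^{-T/2}(1+3r^2V)^{-T/2}\right]}{1-\mathbb{E}\left[(1+4r^2V)^{-T/2}\right]},$$ where $V\sim\mathrm{Gamma}^{-1}(\nu,\nu)$ is inverse gamma distributed with both parameters equal to $\nu$.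
   Context: Let $X,Y,W$ be i.i.d. draws from the attribute distribution $\pi_X$, independent of the random skew-symmetric function $\mathcal{F}$. The variance and the shared-endpoint correlation are $$\sigma^2=\mathbb{E}_{\mathcal{F}}\left[\mathrm{Var}_{X,Y}(\mathcal{F}(X,Y)\mid\mathcal{F})\right],\qquad \rho=\frac{1}{\sigma^2}\,\mathbb{E}_{\mathcal{F}}\left[\mathrm{Cov}_{X,Y,W}(\mathcal{F}(X,Y),\mathcal{F}(X,W)\mid\mathcal{F})\right].$$ The Mat\'ern function is $$h_{\mathrm{Mat}}(s;\ell,\nu)=\frac{2^{1-\nu}}{\Gamma(\nu)}\left(\frac{\sqrt{2\nu}\,s}{\ell}\right)^{\nu}K_\nu\left(\frac{\sqrt{2\nu}\,s}{\ell}\right)\quad(s>0),\qquad h_{\mathrm{Mat}}(0;\ell,\nu)=1,$$ with $K_\nu$ the modified Bessel function of the second kind. The distribution $\mathrm{Gamma}^{-1}(\nu,\nu)$ has density $\frac{\nu^\nu}{\Gamma(\nu)}v^{-(\nu+1)}e^{-\nu/v}$ on $(0,\infty)$. *)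

(* Defs.v *)
From HB Require Import structures.
From mathcomp Require Import all_boot all_order all_algebra.
From mathcomp Require Import all_classical all_reals all_analysis.

Set Implicit Arguments.
Unset Strict Implicit.
Unset Printing Implicit Defensive.

Import Order.TTheory GRing.Theory Num.Theory.
Import numFieldNormedType.Exports.

Local Open Scope classical_set_scope.
Local Open Scope ring_scope.

(* Points of R^n are n.-tuple R, with the product (= Borel) sigma-algebra
   that the library puts on tuples. *)

Section special_functions.
Context {R : realType}.
Notation mu := (@lebesgue_measure R).

Definition gammaF (a : R) : R :=
  \int[mu]_(t in `]0, +oo[) (t `^ (a - 1) * expR (- t)).

Definition cosh (t : R) : R := (expR t + expR (- t)) / 2.

(* Modified Bessel function of the second kind, for x > 0, by its integral
   K_nu(x) = \int_0^oo exp(- x cosh t) cosh(nu t) dt. *)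
Definition besselK (nu x : R) : R :=
  \int[mu]_(t in `]0, +oo[) (expR (- (x * cosh t)) * cosh (nu * t)).

Definition matern (l nu s : R) : R :=
  if s == 0 then 1
  else let u := Num.sqrt (2 * nu) * s / l in
       2 `^ (1 - nu) / gammaF nu * u `^ nu * besselK nu u.

(* Shape a, scale b. *)
Definition inv_gamma_pdf (a b v : R) : R :=
  if 0 < v then b `^ a / gammaF a * v `^ (- (a + 1)) * expR (- (b / v))
  else 0.

Definition inv_gamma_distributed d (Om : measurableType d)
    (P : probability Om R) (a b : R) (V : {RV P >-> R}) : Prop :=
  forall A : set R, measurable A ->
    distribution P V A = (\int[mu]_(v in A) (inv_gamma_pdf a b v)%:E)%E.

Definition eucl_dist n (p q : n.-tuple R) : R :=
  Num.sqrt (\sum_(i < n) (tnth p i - tnth q i) ^+ 2).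

(* sigma_u^2 h_Mat(||[x - v, y - w]||_2), as a function of the two points
   z = (x, y) and z' = (v, w) of R^T x R^T. *)
Definition matern_kernel T (sigma_u l nu : R)
    (z z' : T.-tuple R * T.-tuple R) : R :=
  sigma_u ^+ 2 *
    matern l nu (eucl_dist [tuple of z.1 ++ z.2] [tuple of z'.1 ++ z'.2]).

End special_functions.

Section gaussian.
Context d (Om : measurableType d) (R : realType) (P : probability Om R).

(* The case s = 0 is split off because a Gaussian variable may be constant,
   whereas normal_prob m 0 is not the Dirac mass at m. *)
Definition gaussian_rv (Z : Om -> R) : Prop :=
  measurable_fun setT Z /\
  exists m s : R, 0 <= s /\
    forall A : set R, measurable A ->
      P (Z @^-1` A) = if s == 0 then \d_m A else normal_prob m s A.

(* Gaussian process indexed by I: every finite linear combination is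
   Gaussian. For a finite I this is a Gaussian vector. *)
Definition gaussian_process (I : Type) (G : I -> Om -> R) : Prop :=
  forall (n : nat) (t : 'I_n -> I) (a : 'I_n -> R),
    gaussian_rv (fun w => \sum_(k < n) a k * G (t k) w).

End gaussian.

(* pi is a Gaussian law on R^T with covariance matrix S; its mean is
   arbitrary. *)
Definition gaussian_law (R : realType) T (pi : probability (T.-tuple R) R)
    (S : 'M[R]_T) : Prop :=
  gaussian_process pi (fun (i : 'I_T) (x : T.-tuple R) => tnth x i) /\
  forall i j : 'I_T,
    covariance pi (fun x : T.-tuple R => tnth x i)
                  (fun x : T.-tuple R => tnth x j) = (S i j)%:E.

(* The product rule is required of all measurable A, B, C; taking some of them
   to be setT gives it for the pairs. *)
Definition iid_draws d dE (Om : measurableType d) (E : measurableType dE)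
    (R : realType) (P : probability Om R) (pi : probability E R)
    (X Y W : {RV P >-> E}) : Prop :=
  (forall A : set E, measurable A ->
     [/\ distribution P X A = pi A,
         distribution P Y A = pi A &
         distribution P W A = pi A]) /\
  (forall A B C : set E, measurable A -> measurable B -> measurable C ->
     P ((X @^-1` A) `&` (Y @^-1` B) `&` (W @^-1` C)) =
       (P (X @^-1` A) * P (Y @^-1` B) * P (W @^-1` C))%E).

(* The random function F lives on (Om, PF) and the attributes X, Y, W on
   (Om', PX): they are independent, being coordinates of the product space
   PF x PX. Conditioning on F means fixing w : Om and using PX alone. *)
Section correlation.
Context d d' dE (Om : measurableType d) (Om' : measurableType d')
  (E : measurableType dE) (R : realType)
  (PF : probability Om R) (PX : probability Om' R).

Definition total_variance (F : E -> E -> Om -> R) (X Y : Om' -> E) : \bar R :=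
  (\int[PF]_w 'V_PX[fun a => F (X a) (Y a) w])%E.

Definition shared_endpoint_correlation (F : E -> E -> Om -> R)
    (X Y W : Om' -> E) : \bar R :=
  ((total_variance F X Y)^-1 *
   \int[PF]_w covariance PX (fun a => F (X a) (Y a) w)
                            (fun a => F (X a) (W a) w))%E.

Definition skew_part (U : E * E -> Om -> R) (x y : E) (w : Om) : R :=
  U (x, y) w - U (y, x) w.

End correlation.

(* Main.v *)
(** The Matern function is a scale mixture of Gaussian kernels,
    [h_Mat(s) = E exp(- V s^2 / (2 l^2))] with [V ~ Gamma^-1(nu, nu)] (substitute
    [v = a e^t] in the integral for [K_nu]), so the numerator and the denominator
    reduce to expectations [E exp(- c |Z|^2)] of linear combinations [Z] of the
    attributes.  Such an expectation is evaluated without identifying the law of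
    [X] on [R^T]: [exp(- c z^2)] is itself the characteristic function of a normal
    variable, so replacing it, one coordinate at a time, by [E cos(xi z)] leaves
    only cosines of linear forms of the attributes, which are one-dimensional
    Gaussian by hypothesis.  Conditionally on [F] the means vanish almost surely,
    because [(X, Y)] and [(Y, X)] have the same law and [F] is skew; Fubini then
    turns variance and covariance into averages of the second moments of [F]. *)

(* [gaussian_law] describes linear forms of the coordinates and their covariances. Passing from
   there to the law on R^T would take the uniqueness theorem for characteristic functions;
   randomizing the frequency of a cosine avoids it. As the covariance matrix is scalar, the
   characteristic function factorizes over coordinates, so each expectation is the T-th power of one
   two-dimensional Gaussian integral. The unknown mean of the attributes cancels because only
   differences of attributes occur.

   Expanding the second moments of F leaves three squared lengths: |Y-W|^2, |X-W|^2 + |Y-X|^2 and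
   2|X-Y|^2. A coordinate of Y-W has variance 2 sigma_x^2, which gives 1 + 2 r^2 V, and doubling the
   squared length gives 1 + 4 r^2 V. In each coordinate, X-W and Y-X have covariance matrix
   sigma_x^2 (2, -1; -1, 2), with eigenvalues sigma_x^2 and 3 sigma_x^2, whence the product of 1 +
   r^2 V and 1 + 3 r^2 V. *)
Require Import Defs.
From HB Require Import structures.
From mathcomp Require Import all_boot all_order all_algebra.
From mathcomp Require Import all_classical all_reals all_analysis.
From mathcomp Require Import measurable_realfun normal_distribution.
From mathcomp Require Import ring lra.

Set Implicit Arguments.
Unset Strict Implicit.
Unset Printing Implicit Defensive.

Import Order.TTheory GRing.Theory Num.Theory.
Import numFieldNormedType.Exports.

Local Open Scope classical_set_scope.
Local Open Scope ring_scope.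

(** * Measures with a density *)

Section density.
Context d (T : measurableType d) (R : realType).
Variables (mu nu : {measure set T -> \bar R}) (p : T -> R).
Hypotheses (mp : measurable_fun setT p) (p0 : forall x, 0 <= p x).
Hypothesis nuE : forall A, measurable A -> nu A = (\int[mu]_(x in A) (p x)%:E)%E.

Import HBNNSimple.

(** [nuE] is the case of indicators; linearity extends it to simple functions, and monotone
    convergence along [nnsfun_approx] to all nonnegative [f]. *)
Lemma ge0_integral_density (f : T -> \bar R) :
  measurable_fun setT f -> (forall x, 0 <= f x)%E ->
  (\int[nu]_x f x = \int[mu]_x (f x * (p x)%:E))%E.
Proof.
move=> mf f0; pose g := nnsfun_approx measurableT mf.
have mpE : measurable_fun setT (EFin \o p) by exact/measurable_EFinP.
transitivity (limn (fun n => \int[nu]_x (g n x)%:E)%E).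
  rewrite -monotone_convergence//.
  - by apply: eq_integral => y _; apply/esym/cvg_lim => //; exact: cvg_nnsfun_approx.
  - by move=> n; exact/measurable_EFinP.
  - by move=> n y _; rewrite lee_fin.
  - by move=> y _ m n mn; rewrite lee_fin; exact/lefP/nd_nnsfun_approx.
rewrite [X in limn X](_ : _ =
    (fun n => \int[mu]_x ((g n x)%:E * (p x)%:E)))%E; last first.
  apply/funext => n.
  under eq_integral do rewrite fimfunE -fsumEFin//.
  rewrite ge0_integral_fsum//; last 2 first.
  - by move=> y; apply/measurable_EFinP/measurable_funM => //; exact: measurable_indic.
  - by move=> y x _; rewrite nnfun_muleindic_ge0.
  transitivity (\int[mu]_x \sum_(k \in range (g n))
      (k * \1_(g n @^-1` [set k]) x * p x)%:E)%E; last first.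
    apply: eq_integral => x _; rewrite fsumEFin// -EFinM; congr EFin.
    by rewrite -mulr_fsuml// -fimfunE.
  rewrite ge0_integral_fsum//; last 2 first.
  - move=> y; apply/measurable_EFinP; apply: measurable_funM => //.
    by apply/measurable_funM => //; exact: measurable_indic.
  - by move=> y x _; rewrite EFinM mule_ge0 ?nnfun_muleindic_ge0 ?lee_fin.
  apply: eq_fsbigr => r _; rewrite integralZl_indic_nnsfun// integral_indic//=.
  rewrite setIT nuE//.
  (* A nonnegative simple function takes no negative value, so both sides vanish; otherwise the
     scalar [r >= 0] can be moved through the integral. *)
  have [r0|r0] := ltP r 0.
    rewrite preimage_nnfun0//= integral_set0 mule0.
    by rewrite integral0_eq// => x _; rewrite indic0 mulr0 mul0r.
  rewrite integral_mkcond -ge0_integralZl//; last 2 first.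
  - by apply/(measurable_restrictT (EFin \o p)) => //; exact: measurable_funTS.
  - by move=> x _; apply: erestrict_ge0 => y _; rewrite lee_fin.
  - apply: eq_integral => x _; rewrite patchE indicE.
    by case: ifPn => xg; rewrite -?EFinM ?mulr1 ?mulr0 ?mul0r ?mule0.
rewrite -monotone_convergence//.
- apply: eq_integral => x _; apply/cvg_lim => //.
  by apply: cvgeZr => //; exact: cvg_nnsfun_approx.
- by move=> n; apply: emeasurable_funM => //; exact/measurable_EFinP.
- by move=> n x _; rewrite mule_ge0// lee_fin.
- move=> x _ m n mn; rewrite lee_wpmul2r ?lee_fin//.
  exact/lefP/nd_nnsfun_approx.
Qed.

(** Multiplication by [p >= 0] commutes with positive and negative parts, so both sides are [fine]
    of the same extended real, whether or not [f] is integrable. *)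
Lemma Rintegral_density (f : T -> R) : measurable_fun setT f ->
  \int[nu]_x f x = \int[mu]_x (f x * p x).
Proof.
move=> mf; have mf' : measurable_fun setT (EFin \o f) by exact/measurable_EFinP.
rewrite /Rintegral [X in fine X = _]integralE [X in _ = fine X]integralE.
rewrite !ge0_integral_density//; last 2 first.
- exact: measurable_funeneg.
- exact: measurable_funepos.
congr (fine (_ - _)%E); apply: eq_integral => x _.
- rewrite !funeposE/= -!EFin_max -EFinM maxr_pMl ?mul0r//.
- rewrite !funenegE/= -!EFin_max -EFinM maxr_pMl// mul0r mulNr//.
Qed.

Lemma integrable_density (f : T -> R) : measurable_fun setT f ->
  nu.-integrable setT (EFin \o f) <->
  mu.-integrable setT (EFin \o (fun x => f x * p x)).
Proof.
move=> mf; have mf' : measurable_fun setT (EFin \o f) by exact/measurable_EFinP.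
have e : (\int[nu]_x `|(f x)%:E| = \int[mu]_x `|(f x * p x)%:E|)%E.
  rewrite ge0_integral_density//; last exact: measurableT_comp.
  by apply: eq_integral => x _; rewrite /= normrM (ger0_norm (p0 x)).
split=> /integrableP[_ foo]; apply/integrableP; split => //.
- by apply/measurable_EFinP; exact: measurable_funM.
- by rewrite -e.
- by rewrite e.
Qed.

End density.

(** * Moments and characteristic function of the normal law *)

Section normal_calculus.
Context {R : realType}.
Notation mu := (@lebesgue_measure R).
Variables (m s : R).
Hypothesis s0 : s != 0.

(* A wider normal density gives integrability and decay at infinity at once. *)
Lemma normal_pdf_dominated : exists2 C, 0 <= C & forall x,
  (1 + `|x - m| + (x - m) ^+ 2) * normal_pdf m s x <= C * normal_pdf m (2 * s) x.
Proof.
have s20 : 2 * s != 0 by rewrite mulf_neq0.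
have ss : 0 < s ^+ 2 by rewrite exprn_even_gt0.
(* The gap between the two exponents, 1/(2 s^2) - 1/(2 (2s)^2). The polynomial is absorbed by 1 +
   y^2 <= (1 + 1/k)(1 + k y^2) <= (1 + 1/k) exp(k y^2). *)
pose k := 3 / (8 * s ^+ 2).
have k0 : 0 < k by rewrite divr_gt0// mulr_gt0.
pose C0 := 3 / 2 * (1 + k^-1).
have kV : 0 < k^-1 by rewrite invr_gt0.
have C00 : 0 <= C0 by rewrite /C0; lra.
exists (C0 * (normal_peak s / normal_peak (2 * s))).
  by rewrite mulr_ge0 ?divr_ge0 ?normal_peak_ge0.
move=> x; rewrite !normal_pdfE//=; set y := x - m.
have -> : C0 * (normal_peak s / normal_peak (2 * s)) *
    (normal_peak (2 * s) * normal_fun m (2 * s) x) =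
    normal_peak s * (C0 * normal_fun m (2 * s) x).
  by field; rewrite gt_eqF// normal_peak_gt0.
rewrite mulrCA; apply: ler_wpM2l; first exact: normal_peak_ge0.
have -> : normal_fun m s x = expR (- (k * y ^+ 2)) * normal_fun m (2 * s) x.
  rewrite /normal_fun -/y -expRD; congr expR; rewrite /k; field.
  by rewrite s0.
rewrite mulrA ler_wpM2r ?normal_fun_ge0// expRN ler_pdivrMr ?expR_gt0//.
apply: (@le_trans _ _ (C0 * (1 + k * y ^+ 2))); last first.
  by apply: ler_wpM2l => //; exact: expR_ge1Dx.
have y2 : `|y| ^+ 2 = y ^+ 2 by rewrite real_normK// num_real.
have h1 : 1 + `|y| + y ^+ 2 <= 3 / 2 * (1 + y ^+ 2).
  rewrite -y2; have := sqr_ge0 (`|y| - 1); nra.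
apply: le_trans h1 _; rewrite /C0 -[leRHS]mulrA ler_wpM2l ?divr_ge0//.
have -> : (1 + k^-1) * (1 + k * y ^+ 2) = 1 + y ^+ 2 + (k^-1 + k * y ^+ 2).
  by field; rewrite gt_eqF.
by rewrite lerDl addr_ge0 ?(ltW kV)// mulr_ge0 ?sqr_ge0 ?(ltW k0).
Qed.

Lemma integrable_normal_dominated (f : R -> R) C : measurable_fun setT f ->
  (forall x, `|f x| <= C * normal_pdf m s x) -> mu.-integrable setT (EFin \o f).
Proof.
move=> mf fC.
apply: (@le_integrable _ _ _ mu setT measurableT (EFin \o f)
  (EFin \o (fun x => C * normal_pdf m s x))).
- exact/measurable_EFinP.
- by move=> x _ /=; rewrite lee_fin (le_trans (fC x))// ler_norm.
- have := @integrableZl _ _ _ mu setT measurableT C _ (@integrable_normal_pdf R m s).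
  by apply: eq_integrable => // x _ /=; rewrite EFinM.
Qed.

(** The hypothesis on squares treats both endpoints [n.+1] and [- n.+1] at once. *)
Lemma normal_pdf_cvg0 (u : nat -> R) : (forall n, u n ^+ 2 = n.+1%:R ^+ 2) ->
  normal_pdf m s (u n) @[n --> \oo] --> 0.
Proof.
move=> uE.
pose a := (s ^+ 2 *+ 2)^-1.
have a0 : 0 < a by rewrite invr_gt0 pmulrn_lgt0// exprn_even_gt0.
(* Ratio of a dominating geometric sequence: (u - m)^2 >= u^2/2 - m^2 and (n+1)^2 >= n. *)
pose b := expR (- (a / 2)).
have b1 : `|b| < 1 by rewrite ger0_norm ?expR_ge0// expR_lt1 oppr_lt0 divr_gt0.
pose c := normal_peak s * expR (a * m ^+ 2).
apply: (@squeeze_cvgr _ _ _ _ (cst 0) (geometric c b)).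
- near=> n; rewrite normal_pdf_ge0/= normal_pdfE//= /c -mulrA.
  rewrite ler_wpM2l ?normal_peak_ge0// /b -expRM_natr -expRD ler_expR.
  have n1 : (n%:R : R) <= n.+1%:R ^+ 2.
    rewrite -natrX ler_nat; apply: (@leq_trans n.+1) => //.
    by rewrite -{1}(expn1 n.+1) leq_pexp2l.
  have : n%:R / 2 - m ^+ 2 <= (u n - m) ^+ 2.
    have := uE n; have := sqr_ge0 (u n - 2 * m); nra.
  move=> /(ler_wpM2l (ltW a0)); rewrite mulNr -/a; lra.
- exact: cvg_cst.
- by apply: cvg_geometric.
Unshelve. all: by end_near. Qed.


(** Integration by parts on the whole line: a primitive dominated by a normal density has no
    boundary terms at infinity. The mean, the variance and the by-parts identity for the sine come
    from three choices of [F]. *)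
Lemma Rintegral_derive_eq0 (F f : R -> R) C :
  (forall x : R, is_derive x (1:R) F (f x)) -> continuous f ->
  (forall x, `|F x| <= C * normal_pdf m s x) ->
  (forall x, `|f x| <= C * normal_pdf m s x) -> \int[mu]_x f x = 0.
Proof.
move=> dF cf FC fC.
have mf : measurable_fun setT f by exact: continuous_measurable_fun.
have intf : mu.-integrable setT (EFin \o f) by exact: integrable_normal_dominated fC.
have cF : continuous F.
  move=> x; apply/differentiable_continuous/derivable1_diffP.
  exact: (@ex_derive _ _ _ _ _ _ _ (dF x)).
(* The radius [n.+1] instead of [n] keeps the interval non-degenerate at [n = 0], as the fundamental
   theorem of calculus requires. *)
pose D n : set R := `[- n.+1%:R, n.+1%:R]%classic.
have FTC n : (\int[mu]_(x in D n) (f x)%:E =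
    (F n.+1%:R - F (- n.+1%:R))%:E)%E.
  rewrite EFinB; apply: continuous_FTC2 => //.
  - by rewrite gtrN.
  - exact: continuous_subspaceT.
  - split => [x _||]; first exact: (@ex_derive _ _ _ _ _ _ _ (dF x)).
    + by apply: cvg_at_right_filter; exact: cF.
    + by apply: cvg_at_left_filter; exact: cF.
  - by move=> x _; rewrite derive1E; exact: (@derive_val _ _ _ _ _ _ _ (dF x)).
have F0 (u : nat -> R) : (forall n, u n ^+ 2 = n.+1%:R ^+ 2) ->
    F (u n) @[n --> \oo] --> 0.
  move=> uE; apply: norm_cvg0.
  apply: (@squeeze_cvgr _ _ _ _ (cst 0) (fun n => C * normal_pdf m s (u n))).
  - by near=> n; rewrite normr_ge0/= FC.
  - exact: cvg_cst.
  - by rewrite -(mulr0 C); apply: cvgM; [exact: cvg_cst|exact: normal_pdf_cvg0].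
have lim0 : (\int[mu]_(x in D n) (f x)%:E)%E @[n --> \oo] --> 0%E.
  under eq_fun do rewrite FTC.
  apply: cvg_EFin; first by near=> n.
  rewrite -[X in _ --> X](subr0 0); apply: cvgB; apply: F0 => // n.
  by rewrite sqrrN.
have limI : (\int[mu]_(x in D n) (f x)%:E)%E @[n --> \oo] --> (\int[mu]_x (f x)%:E)%E.
  under eq_fun do rewrite integral_mkcond.
  apply: (@dominated_cvg _ _ _ mu setT measurableT _ _ (fun x => `|f x|%:E)).
  - by move=> n; apply/(measurable_restrictT (EFin \o f)) => //;
      [exact: measurable_itv|exact/measurable_funTS/measurable_EFinP].
  - move=> x _; apply: cvg_near_cst; near=> n.
    rewrite patchE mem_set// /D /= in_itv/= -ler_norml.
    apply: (@le_trans _ _ n%:R); last by rewrite ler_nat.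
    near: n; exact: nbhs_infty_ger.
  - by [].
  - exact: (integrable_norm intf).
  - move=> n x _; rewrite patchE; case: ifPn => _ //=.
    by rewrite normr0 lee_fin.
by rewrite /Rintegral (cvg_unique _ limI lim0).
Unshelve. all: by end_near. Qed.

End normal_calculus.

Section normal_moments.
Context {R : realType}.
Notation mu := (@lebesgue_measure R).
Variables (m s : R).
Hypothesis s0 : s != 0.
Let s20 : 2 * s != 0. Proof. by rewrite mulf_neq0. Qed.
Notation g := (normal_pdf m s).

Lemma is_derive_normal_pdf (x : R) :
  is_derive x (1 : R) g (- ((x - m) / s ^+ 2) * g x).
Proof.
rewrite normal_pdfE//= /normal_fun.
apply: is_derive_eq; rewrite /GRing.scale/=; field.
by rewrite s0.
Qed.

Let gnorm x : `|g x| = g x.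
Proof. by rewrite ger0_norm// normal_pdf_ge0. Qed.

Lemma normal_mean0 : \int[mu]_x ((x - m) * g x) = 0.
Proof.
have [C C0 dom] := normal_pdf_dominated m s0.
have C10 : 0 <= (1 + s ^+ 2) * C by rewrite mulr_ge0// addr_ge0// sqr_ge0.
apply: (@Rintegral_derive_eq0 _ m (2 * s) s20 (fun x => - s ^+ 2 * g x)
  (fun x => (x - m) * g x) ((1 + s ^+ 2) * C)).
- move=> x; have dg := is_derive_normal_pdf x.
  apply: is_derive_eq; rewrite /GRing.scale/=; field.
  by rewrite s0.
- move=> x; apply: cvgM; last exact: continuous_normal_pdf.
  by apply: (@cvgB _ R^o); [exact: cvg_id|exact: cvg_cst].
- move=> x; rewrite normrM normrN (ger0_norm (sqr_ge0 s)) gnorm.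
  have := dom x; have := normal_pdf_ge0 m s x; have := normr_ge0 (x - m).
  have := sqr_ge0 (x - m); have := sqr_ge0 s; set S := s ^+ 2.
  move=> S0 y2 y1 G0 H.
  apply: (@le_trans _ _ (S * (C * normal_pdf m (2 * s) x))); last first.
    rewrite mulrA ler_wpM2r ?normal_pdf_ge0//; nra.
  apply: ler_wpM2l => //; apply: le_trans H; nra.
- move=> x; rewrite normrM gnorm.
  have := dom x; have := normal_pdf_ge0 m s x; have := normr_ge0 (x - m).
  have := sqr_ge0 (x - m); have := sqr_ge0 s; set S := s ^+ 2.
  move=> S0 y2 y1 G0 H.
  apply: (@le_trans _ _ (C * normal_pdf m (2 * s) x)); last first.
    rewrite ler_wpM2r ?normal_pdf_ge0//; nra.
  apply: le_trans H; nra.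
Qed.

Lemma normal_variance0 : \int[mu]_x ((x - m) ^+ 2 * g x) = s ^+ 2.
Proof.
have [C C0 dom] := normal_pdf_dominated m s0.
have C10 : 0 <= (1 + s ^+ 2) * C by rewrite mulr_ge0// addr_ge0// sqr_ge0.
have ib (h : R -> R) : measurable_fun setT h ->
   (forall x, `|h x| <= 1 + `|x - m| + (x - m) ^+ 2) ->
   mu.-integrable setT (EFin \o (fun x => h x * g x)).
  move=> mh hb; apply: (@integrable_normal_dominated _ m (2 * s) _ C) => //.
    by apply: measurable_funM => //; exact: measurable_normal_pdf.
  move=> x; apply: le_trans (dom x); rewrite normrM gnorm.
  by rewrite ler_wpM2r ?normal_pdf_ge0.
have mx : measurable_fun setT (fun x : R => x - m) by exact: measurable_funB.
have ig : mu.-integrable setT (EFin \o g).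
  exact: integrable_normal_pdf.
have ix2 : mu.-integrable setT (EFin \o (fun x => (x - m) ^+ 2 * g x)).
  apply: ib; first exact: measurable_funX.
  by move=> x; rewrite ger0_norm ?sqr_ge0//; have := normr_ge0 (x - m); lra.
have : \int[mu]_x ((x - m) ^+ 2 * g x - s ^+ 2 * g x) = 0.
  apply: (@Rintegral_derive_eq0 _ m (2 * s) s20 (fun x => - s ^+ 2 * ((x - m) * g x))
    (fun x => (x - m) ^+ 2 * g x - s ^+ 2 * g x) ((1 + s ^+ 2) * C)).
  - move=> x; have dg := is_derive_normal_pdf x.
    apply: is_derive_eq; rewrite /GRing.scale/=; field.
    by rewrite s0.
  - move=> x; apply: (@cvgB _ R^o); apply: cvgM; try exact: continuous_normal_pdf; last exact: cvg_cst.
    apply: (cvg_comp (fun x => x - m) (fun x => x ^+ 2)); last exact: sqr_continuous.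
    by apply: (@cvgB _ R^o); [exact: cvg_id|exact: cvg_cst].
  - move=> x; rewrite normrM normrN (ger0_norm (sqr_ge0 s)) normrM gnorm.
    have := dom x; have := normal_pdf_ge0 m s x; have := normr_ge0 (x - m).
    have := sqr_ge0 (x - m); have := sqr_ge0 s; set S := s ^+ 2.
    move=> S0 y2 y1 G0 H.
    apply: (@le_trans _ _ (S * (C * normal_pdf m (2 * s) x))); last first.
      rewrite mulrA ler_wpM2r ?normal_pdf_ge0//; nra.
    apply: ler_wpM2l => //; apply: le_trans H; nra.
  - move=> x; rewrite -mulrBl normrM gnorm.
    have := dom x; have := normal_pdf_ge0 m s x; have := normr_ge0 (x - m).
    have := sqr_ge0 (x - m); have := sqr_ge0 s; set S := s ^+ 2.
    move=> S0 y2 y1 G0 H.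
    have N : `|(x - m) ^+ 2 - S| <= (1 + S) * (1 + (x - m) ^+ 2).
      rewrite ler_norml; apply/andP; split; nra.
    apply: (@le_trans _ _ ((1 + S) * (C * normal_pdf m (2 * s) x))); last first.
      by rewrite mulrA.
    apply: (@le_trans _ _ ((1 + S) * ((1 + `|x - m| + (x - m) ^+ 2) * g x))); last first.
      by apply: ler_wpM2l => //; rewrite addr_ge0.
    rewrite mulrA ler_wpM2r//; apply: le_trans N _; apply: ler_wpM2l; nra.
rewrite RintegralB//; last first.
  have := @integrableZl _ _ _ mu setT measurableT (s ^+ 2) _ ig.
  by apply: eq_integrable => // x _ /=; rewrite EFinM.
move/eqP; rewrite subr_eq0 => /eqP ->.
rewrite RintegralZl// /Rintegral integral_normal_pdf/= mulr1 //.
Qed.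

End normal_moments.

Section normal_charfun.
Context {R : realType}.
Notation mu := (@lebesgue_measure R).
Variables (m s : R).
Hypothesis s0 : s != 0.
Let s20 : 2 * s != 0. Proof. by rewrite mulf_neq0. Qed.
Notation g := (normal_pdf m s).

Let gnorm x : `|g x| = g x.
Proof. by rewrite ger0_norm// normal_pdf_ge0. Qed.

Let mcos (t th : R) : measurable_fun setT (fun x : R => cos (t * (x - m) + th)).
Proof.
apply: measurableT_comp; first exact: continuous_measurable_fun (@continuous_cos R).
by apply: measurable_funD => //; apply: measurable_funM => //; exact: measurable_funB.
Qed.

Let icos (t th : R) :
  mu.-integrable setT (EFin \o (fun x : R => cos (t * (x - m) + th) * g x)).
Proof.
apply: (@integrable_normal_dominated _ m s _ 1) => //.
  by apply: measurable_funM => //; exact: measurable_normal_pdf.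
by move=> x; rewrite normrM gnorm ler_wpM2r ?normal_pdf_ge0 ?cos_max.
Qed.

Let affine_cvg (t th : R) : continuous (fun x : R => t * (x - m) + th).
Proof.
move=> x; apply: (@cvgD _ R^o); last exact: cvg_cst.
apply: cvgM; first exact: cvg_cst.
by apply: (@cvgB _ R^o); [exact: cvg_id|exact: cvg_cst].
Qed.

(** Stein's identity for the sine: the difference of the two integrands is the derivative of
    [s ^+ 2 * (sin (t * (x - m) + th) * g x)]. *)
Lemma normal_sin_by_parts (t th : R) :
  \int[mu]_x ((x - m) * sin (t * (x - m) + th) * g x) =
  t * s ^+ 2 * \int[mu]_x (cos (t * (x - m) + th) * g x).
Proof.
have [C C0 dom] := normal_pdf_dominated m s0.
(* One constant large enough for both the primitive, whose coefficient is [s ^+ 2], and its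
   derivative, whose coefficients are bounded by 1 and [|t| s^2]. *)
pose K := 1 + (1 + `|t|) * s ^+ 2.
have ss := sqr_ge0 s; have tt := normr_ge0 t.
have K1 : s ^+ 2 <= K by rewrite /K; nra.
have K2 : 1 + `|t| * s ^+ 2 <= K by rewrite /K; nra.
have K3 : 1 <= K by rewrite /K; nra.
have isin : mu.-integrable setT
    (EFin \o (fun x : R => (x - m) * sin (t * (x - m) + th) * g x)).
  apply: (@integrable_normal_dominated _ m (2 * s) _ C).
    apply: measurable_funM; last exact: measurable_normal_pdf.
    apply: measurable_funM; first exact: measurable_funB.
    apply: measurableT_comp; first exact: continuous_measurable_fun (@continuous_sin R).
    by apply: measurable_funD => //; apply: measurable_funM => //; exact: measurable_funB.
  move=> x; apply: le_trans (dom x); rewrite !normrM gnorm ler_wpM2r ?normal_pdf_ge0//.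
  have := sin_max (t * (x - m) + th); have := sqr_ge0 (x - m).
  have := normr_ge0 (x - m); nra.
pose h x := t * s ^+ 2 * (cos (t * (x - m) + th) * g x)
            - (x - m) * sin (t * (x - m) + th) * g x.
have : \int[mu]_x h x = 0.
  apply: (@Rintegral_derive_eq0 _ m (2 * s) s20
    (fun x => s ^+ 2 * (sin (t * (x - m) + th) * g x)) h (K * C)); rewrite /h.
  - move=> x; have dg := is_derive_normal_pdf m s0 x.
    apply: is_derive_eq; rewrite /GRing.scale/=; field.
    by rewrite s0.
  - move=> x; apply: (@cvgB _ R^o); apply: cvgM; try exact: continuous_normal_pdf.
    + exact: cvg_cst.
    + apply: cvgM; last exact: continuous_normal_pdf.
      apply: (cvg_comp (fun x => t * (x - m) + th) cos); first exact: affine_cvg.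
      exact: continuous_cos.
    + apply: cvgM; first by apply: (@cvgB _ R^o); [exact: cvg_id|exact: cvg_cst].
      apply: (cvg_comp (fun x => t * (x - m) + th) sin); first exact: affine_cvg.
      exact: continuous_sin.
  - move=> x; rewrite normrM (ger0_norm (sqr_ge0 s)) normrM gnorm.
    rewrite -[leRHS]mulrA.
    apply: (@le_trans _ _ (K * ((1 + `|x - m| + (x - m) ^+ 2) * g x))).
      apply: ler_pM => //; first by apply: mulr_ge0; rewrite ?normal_pdf_ge0.
      rewrite ler_wpM2r ?normal_pdf_ge0//.
      have := sin_max (t * (x - m) + th); have := sqr_ge0 (x - m).
      have := normr_ge0 (x - m); nra.
    by apply: ler_wpM2l; [lra|exact: dom].
  - move=> x; rewrite mulrA -mulrBl normrM gnorm.
    rewrite -[leRHS]mulrA; apply: (@le_trans _ _ (K * ((1 + `|x - m| + (x - m) ^+ 2) * g x))).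
      rewrite mulrA ler_wpM2r ?normal_pdf_ge0//.
      apply: le_trans (ler_normB _ _) _; rewrite (normrM (t * s ^+ 2)) (normrM t) (ger0_norm ss) normrM.
      have A := sin_max (t * (x - m) + th).
      have B := cos_max (t * (x - m) + th).
      have X := normr_ge0 (x - m); have X2 := sqr_ge0 (x - m).
      apply: (@le_trans _ _ (`|t| * s ^+ 2 + `|x - m|)).
        apply: lerD; last by rewrite ler_piMr.
        by rewrite ler_piMr// mulr_ge0.
      apply: (@le_trans _ _ (K * (1 + `|x - m|))); last by apply: ler_wpM2l; lra.
      nra.
    by apply: ler_wpM2l; [lra|exact: dom].
rewrite RintegralB//; last first.
  have := @integrableZl _ _ _ mu setT measurableT (t * s ^+ 2) _ (icos t th).
  by apply: eq_integrable => // x _ /=; rewrite EFinM.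
by rewrite RintegralZl// => /eqP; rewrite subr_eq0 => /eqP ->.
Qed.

(** Differentiation under the integral with a dominating function [G] independent of [t], followed
    by [normal_sin_by_parts]. The result is a linear differential equation for the characteristic
    function. *)
Lemma is_derive_normal_cos (th a : R) :
  is_derive a (1 : R) (fun t => \int[mu]_x (cos (t * (x - m) + th) * g x))
    (- (a * s ^+ 2) * \int[mu]_x (cos (a * (x - m) + th) * g x)).
Proof.
have [C C0 dom] := normal_pdf_dominated m s0.
pose f (t x : R) := cos (t * (x - m) + th) * g x.
have df t x : is_derive t (1:R) (f ^~ x) (- ((x - m) * sin (t * (x - m) + th) * g x)).
  rewrite /f; apply: is_derive_eq; rewrite /GRing.scale/=; ring.
have Ia : `]a - 1, a + 1[%classic a by rewrite /= in_itv/=; lra.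
have intf (t : R) : `]a - 1, a + 1[%classic t -> mu.-integrable setT (EFin \o f t)
  by move=> _; exact: icos.
have derf (t y : R) : `]a - 1, a + 1[%classic t -> [set: R] y -> derivable (f^~ y) t 1.
  by move=> _ _; exact: (@ex_derive _ _ _ _ _ _ _ (df t y)).
pose G (x : R) := C * normal_pdf m (2 * s) x.
have G0 y : 0 <= G y by rewrite mulr_ge0 ?normal_pdf_ge0.
have iG : mu.-integrable setT (EFin \o G).
  have := @integrableZl _ _ _ mu setT measurableT C _ (@integrable_normal_pdf R m (2 * s)).
  by apply: eq_integrable => // x _ /=; rewrite EFinM.
have d1E (t y : R) : (partial1of2 f) t y = - ((y - m) * sin (t * (y - m) + th) * g y).
  by rewrite partial1of2E; exact: (@derive_val _ _ _ _ _ _ _ (df t y)).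
have Gub (t y : R) : `]a - 1, a + 1[%classic t -> [set: R] y -> `|partial1of2 f t y| <= G y.
  move=> _ _; rewrite d1E normrN; apply: le_trans (dom y).
  rewrite !normrM gnorm ler_wpM2r ?normal_pdf_ge0//.
  have := sin_max (t * (y - m) + th); have := sqr_ge0 (y - m).
  have := normr_ge0 (y - m); nra.
have dF := @derivable_under_integral _ _ _ mu f setT measurableT a _ _ Ia intf derf G G0 iG Gub.
have := @differentiation_under_integral _ _ _ mu f setT measurableT a _ _ Ia intf derf G G0 iG Gub.
rewrite derive1E => DE.
apply: DeriveDef; first exact: dF.
rewrite DE; under eq_Rintegral do rewrite d1E.
rewrite mulNr -normal_sin_by_parts.
rewrite -[RHS]mulN1r -RintegralZl//; last first.
  apply: (@integrable_normal_dominated _ m (2 * s) _ C).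
    apply: measurable_funM; last exact: measurable_normal_pdf.
    apply: measurable_funM; first exact: measurable_funB.
    apply: measurableT_comp; first exact: continuous_measurable_fun (@continuous_sin R).
    by apply: measurable_funD => //; apply: measurable_funM => //; exact: measurable_funB.
  move=> x; apply: le_trans (dom x); rewrite !normrM gnorm ler_wpM2r ?normal_pdf_ge0//.
  have := sin_max (a * (x - m) + th); have := sqr_ge0 (x - m).
  have := normr_ge0 (x - m); nra.
by apply: eq_Rintegral => x _; rewrite mulN1r.
Qed.

(** The phase [th] lets one real integral carry both the real and the imaginary part of the
    characteristic function. Multiplying by the inverse Gaussian factor gives a function with zero
    derivative, evaluated at [t = 0]. *)
Lemma normal_charfun (t th : R) :
  \int[mu]_x (cos (t * (x - m) + th) * g x) = cos th * expR (- (s ^+ 2 * t ^+ 2 / 2)).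
Proof.
(* Phi' t = - s^2 t Phi t *)
pose Phi t := \int[mu]_x (cos (t * (x - m) + th) * g x).
pose H t := Phi t * expR (s ^+ 2 * t ^+ 2 / 2).
have dH u : is_derive u (1:R) H 0.
  have dPhi : is_derive u (1:R) Phi (- (u * s ^+ 2) * Phi u) := is_derive_normal_cos th u.
  by apply: is_derive_eq; rewrite /GRing.scale/=; field.
have := is_derive_0_is_cst t 0 dH.
rewrite /H expr0n/= mulr0 mul0r expR0 mulr1 expRN -/(Phi t) => HE.
have -> : cos th = Phi 0.
  rewrite /Phi; under eq_Rintegral do rewrite mul0r add0r.
  rewrite RintegralZl//; last exact: integrable_normal_pdf.
  by rewrite /Rintegral integral_normal_pdf mulr1.
by rewrite -HE mulfK// gt_eqF// expR_gt0.
Qed.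

End normal_charfun.

(** * Integration against a probability *)

Lemma EFin_Rintegral d (T : measurableType d) (R : realType)
    (mu : {measure set T -> \bar R}) (f : T -> R) :
  mu.-integrable setT (EFin \o f) -> (\int[mu]_x (f x)%:E = (\int[mu]_x f x)%:E)%E.
Proof. by move=> fi; rewrite /Rintegral fineK//; exact: (integrable_fin_num measurableT fi). Qed.

Section Rintegral_complements.
Context d (T : measurableType d) (R : realType).

Lemma bounded_integrable (P : probability T R) (f : T -> R) (C : R) :
  measurable_fun setT f -> (forall x, `|f x| <= C) ->
  P.-integrable setT (EFin \o f).
Proof.
move=> mf fC; apply: measurable_bounded_integrable => //.
  by rewrite (le_lt_trans (probability_le1 _ _))// ltry.
exists C; split; first exact: num_real.
by move=> M CM x _ /=; rewrite (le_trans (fC x))// ltW.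
Qed.

Lemma integrable_sum_EFin (mu : {measure set T -> \bar R}) (I : Type) (r : seq I)
    (f : I -> T -> R) : (forall i, mu.-integrable setT (EFin \o f i)) ->
  mu.-integrable setT (EFin \o (fun x => \sum_(i <- r) f i x)).
Proof.
move=> fi; elim: r => [|i r IH].
  under [X in integrable _ _ X]eq_fun do rewrite /= big_nil.
  exact: integrable0.
apply: eq_integrable (integrableD measurableT (fi i) IH) => // x _ /=.
by rewrite big_cons EFinD.
Qed.

Lemma Rintegral_sum (mu : {measure set T -> \bar R}) (I : Type) (r : seq I)
    (f : I -> T -> R) : (forall i, mu.-integrable setT (EFin \o f i)) ->
  \int[mu]_x (\sum_(i <- r) f i x) = \sum_(i <- r) \int[mu]_x f i x.
Proof.
move=> fi; elim: r => [|i r IH].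
  under eq_Rintegral do rewrite big_nil.
  by rewrite big_nil /Rintegral integral0.
under eq_Rintegral do rewrite big_cons.
by rewrite RintegralD// ?IH ?big_cons//; exact: integrable_sum_EFin.
Qed.

Lemma Rintegral_prob_cst (P : probability T R) (c : R) : \int[P]_x c = c.
Proof. rewrite Rintegral_cst//. by rewrite [X in fine X]probability_setT mulr1. Qed.

Lemma integrable_mul_sqr (mu : {measure set T -> \bar R}) (f g : T -> R) :
  measurable_fun setT f -> measurable_fun setT g ->
  mu.-integrable setT (EFin \o (fun x => f x ^+ 2)) ->
  mu.-integrable setT (EFin \o (fun x => g x ^+ 2)) ->
  mu.-integrable setT (EFin \o (fun x => f x * g x)).
Proof.
move=> mf mg f2 g2.
pose h x := f x ^+ 2 + g x ^+ 2.
apply: (@le_integrable _ _ _ mu setT measurableT _ (EFin \o h)).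
- by apply/measurable_EFinP; exact: measurable_funM.
- move=> x _ /=; have h0 : 0 <= h x by rewrite addr_ge0 ?sqr_ge0.
  rewrite lee_fin (ger0_norm h0) normrM /h.
  have := sqr_ge0 (`|f x| - `|g x|); have := sqr_ge0 (f x); have := sqr_ge0 (g x).
  rewrite -(real_normK (num_real (f x))) -(real_normK (num_real (g x))); nra.
- exact: eq_integrable (integrableD measurableT f2 g2).
Qed.

Lemma integrable_of_sqr (P : probability T R) (f : T -> R) :
  measurable_fun setT f -> P.-integrable setT (EFin \o (fun x => f x ^+ 2)) ->
  P.-integrable setT (EFin \o f).
Proof.
move=> mf f2.
have i1 : P.-integrable setT (EFin \o (fun=> 1 : R)).
  by apply: (@bounded_integrable _ _ 1) => // x; rewrite normr1.
apply: (@le_integrable _ _ _ P setT measurableT _ (EFin \o (fun w => 1 + f w ^+ 2))).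
- exact/measurable_EFinP.
- move=> w _ /=; rewrite lee_fin [leRHS]ger0_norm ?addr_ge0 ?sqr_ge0//.
  rewrite -(real_normK (num_real (f w))); have := sqr_ge0 (`|f w| - 1); nra.
- exact: eq_integrable (integrableD measurableT i1 f2).
Qed.

Lemma Rintegral_law d' (T' : measurableType d') (P : probability T R)
    (X : {mfun T >-> T'}) (f : T' -> R) : measurable_fun setT f ->
  \int[distribution P X]_y f y = \int[P]_x f (X x).
Proof.
move=> mf; have mf' : measurable_fun setT (EFin \o f) by exact/measurable_EFinP.
rewrite /Rintegral [X in fine X = _]integralE [X in _ = fine X]integralE.
rewrite !ge0_integral_distribution//; last 2 first.
- exact: measurable_funeneg.
- exact: measurable_funepos.
by rewrite -funepos_comp -funeneg_comp.
Qed.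

Lemma integrable_law d' (T' : measurableType d') (P : probability T R)
    (X : {mfun T >-> T'}) (f : T' -> R) : measurable_fun setT f ->
  (distribution P X).-integrable setT (EFin \o f) <->
  P.-integrable setT (EFin \o (f \o X)).
Proof.
move=> mf; have mf' : measurable_fun setT (EFin \o f) by exact/measurable_EFinP.
have e : (\int[distribution P X]_y `|(f y)%:E| = \int[P]_x `|(f (X x))%:E|)%E.
  by rewrite ge0_integral_distribution//; exact: measurableT_comp.
split=> /integrableP[_ foo]; apply/integrableP; split => //.
- by apply/measurable_EFinP; exact: measurableT_comp.
- by rewrite -e.
- by rewrite e.
Qed.

End Rintegral_complements.

(** * Fubini's theorem for bounded functions under two probabilities *)

Section Rfubini.
Context d1 d2 (T1 : measurableType d1) (T2 : measurableType d2) (R : realType).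
Variables (P1 : probability T1 R) (P2 : probability T2 R) (f : T1 * T2 -> R) (C : R).
Hypothesis mf : measurable_fun setT f.
Hypothesis fC : forall z, `|f z| <= C.

Let intf : (P1 \x P2)%E.-integrable setT (EFin \o f).
Proof. exact: (@bounded_integrable _ _ _ ((P1 \x P2)%E : probability _ _) f C mf fC). Qed.

Let inner1 x : P2.-integrable setT (EFin \o (fun y => f (x, y))).
Proof.
apply: (@bounded_integrable _ _ _ _ _ C) => //.
exact: measurableT_comp mf (pair1_measurable x).
Qed.

Let inner2 y : P1.-integrable setT (EFin \o (fun x => f (x, y))).
Proof.
apply: (@bounded_integrable _ _ _ _ _ C) => //.
exact: measurableT_comp mf (pair2_measurable y).
Qed.

Lemma Rfubini12 : \int[(P1 \x P2)%E]_z f z = \int[P1]_x \int[P2]_y f (x, y).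
Proof.
rewrite {1}/Rintegral -integral12_prod_meas1// /fubini_F {1}/Rintegral.
congr fine; apply: eq_integral => x _; rewrite /Rintegral fineK//.
exact: integrable_fin_num (inner1 x).
Qed.

Lemma Rfubini21 : \int[(P1 \x P2)%E]_z f z = \int[P2]_y \int[P1]_x f (x, y).
Proof.
rewrite {1}/Rintegral -integral21_prod_meas1// /fubini_G {1}/Rintegral.
congr fine; apply: eq_integral => x _; rewrite /Rintegral fineK//.
exact: integrable_fin_num (inner2 x).
Qed.

Lemma Rfubini :
  \int[P1]_x \int[P2]_y f (x, y) = \int[P2]_y \int[P1]_x f (x, y).
Proof. by rewrite -Rfubini12 Rfubini21. Qed.

Lemma measurable_Rfubini : measurable_fun setT (fun x => \int[P2]_y f (x, y)).
Proof.
apply/measurable_EFinP.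
rewrite (_ : _ \o _ = fubini_F P2 (EFin \o f)); first exact: (measurable_fubini_F intf).
apply/funext => x; rewrite /fubini_F/= /Rintegral fineK//.
exact: integrable_fin_num (inner1 x).
Qed.

End Rfubini.

(** * Gaussian and i.i.d. attributes *)

Section gaussian_rv_theory.
Context d (Om : measurableType d) (R : realType) (P : probability Om R).
Notation mu := (@lebesgue_measure R).

(** The integral formula and the integrability criterion are stated together so that they share the
    same [m] and [s]; the Dirac case stays separate as in [gaussian_rv]. *)
Lemma gaussian_rv_law (Z : Om -> R) : gaussian_rv P Z ->
  exists m s : R, (forall f : R -> R, measurable_fun setT f ->
     \int[P]_w f (Z w) = if s == 0 then f m else \int[mu]_x (f x * normal_pdf m s x)) /\
    (forall f : R -> R, measurable_fun setT f ->
      (s != 0 -> mu.-integrable setT (EFin \o (fun x => f x * normal_pdf m s x))) ->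
      P.-integrable setT (EFin \o (f \o Z))).
Proof.
move=> [mZ [m [s [s0 lawZ]]]]; exists m, s.
pose Z' : {mfun Om >-> measurableTypeR R} := 
  @mfun_Sub _ _ Om (measurableTypeR R) Z (mem_set mZ).
have law0 : s = 0 -> forall A : set R, measurable A -> distribution P Z' A = \d_m A.
  by move=> s00 A mA; rewrite /distribution/= /pushforward/= lawZ// s00 eqxx.
have law1 : s != 0 -> forall A : set R, measurable A ->
    distribution P Z' A = (\int[mu]_(x in A) (normal_pdf m s x)%:E)%E.
  by move=> s00 A mA; rewrite /distribution/= /pushforward/= lawZ// (negbTE s00).
have mg : measurable_fun setT (normal_pdf m s) by exact: measurable_normal_pdf.
have g0 x : 0 <= normal_pdf m s x by exact: normal_pdf_ge0.
split=> f mf => [|fi].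
  rewrite -(Rintegral_law P Z' mf); case: ifPn => [/eqP s00|s00].
    rewrite /Rintegral (@eq_measure_integral _ (measurableTypeR R) R setT (@dirac _ (measurableTypeR R) m R)); last first.
      by move=> A mA _; exact: law0.
    rewrite integral_dirac//; first by rewrite diracT mul1e.
    exact: measurableT_comp.
  exact: (@Rintegral_density _ _ R mu (distribution P Z') _ mg g0 (law1 s00)).
apply/(integrable_law P Z' mf).
have [s00|s00] := eqVneq s 0; last first.
  by apply/(@integrable_density _ _ R mu (distribution P Z') _ mg g0 (law1 s00) _ mf); exact: fi.
apply/integrableP; split; first exact/measurable_EFinP.
rewrite (@eq_measure_integral _ (measurableTypeR R) R setT (@dirac _ (measurableTypeR R) m R)); last by move=> A mA _; exact: law0.
rewrite integral_dirac//=; last by do 2 apply: measurableT_comp => //.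
by rewrite diracT mul1e ltry.
Qed.

(** The parameters [m] and [s] are traded for the mean and variance of [Z], which can be computed
    for a linear form of coordinates. Constant [Z] fits the same formula, with variance 0. *)
Lemma gaussian_rv_charfun (Z : Om -> R) : gaussian_rv P Z ->
  let mZ := \int[P]_w Z w in
  [/\ P.-integrable setT (EFin \o Z),
      P.-integrable setT (EFin \o (fun w => (Z w - mZ) ^+ 2)) &
      forall th, \int[P]_w cos (Z w + th) =
        cos (mZ + th) * expR (- ((\int[P]_w (Z w - mZ) ^+ 2) / 2))].
Proof.
move=> /gaussian_rv_law[m [s [lawZ intZ]]] mZ.
have mid : measurable_fun setT (fun x : R => x) by exact: measurable_id.
have msub : measurable_fun setT (fun x : R => x - m) by exact: measurable_funB.
have msq : measurable_fun setT (fun x : R => (x - m) ^+ 2) by exact: measurable_funX.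
have dom (f : R -> R) : s != 0 -> measurable_fun setT f ->
    (forall x, `|f x| <= 1 + `|x - m| + (x - m) ^+ 2) ->
    mu.-integrable setT (EFin \o (fun x => f x * normal_pdf m s x)).
  move=> s0 mf fb; have [C C0 domC] := normal_pdf_dominated m s0.
  apply: (@integrable_normal_dominated _ m (2 * s) _ C).
    by apply: measurable_funM => //; exact: measurable_normal_pdf.
  move=> x; apply: le_trans (domC x).
  by rewrite normrM (ger0_norm (normal_pdf_ge0 m s x)) ler_wpM2r ?normal_pdf_ge0.
have isub : s != 0 -> mu.-integrable setT (EFin \o (fun x => (x - m) * normal_pdf m s x)).
  by move=> s0; apply: dom => // x; have := sqr_ge0 (x - m); lra.
have isq : s != 0 -> mu.-integrable setT (EFin \o (fun x => (x - m) ^+ 2 * normal_pdf m s x)).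
  move=> s0; apply: dom => // x; rewrite ger0_norm ?sqr_ge0//.
  by have := normr_ge0 (x - m); lra.
have iZm : P.-integrable setT (EFin \o (fun w => Z w - m)).
  exact: (intZ _ msub isub).
have icst : P.-integrable setT (EFin \o (fun w : Om => m)).
  by apply: (@bounded_integrable _ _ _ _ _ `|m|) => //.
have iZ : P.-integrable setT (EFin \o Z).
  apply: eq_integrable (integrableD measurableT iZm icst) => // w _ /=.
  by rewrite -EFinD subrK.
have mZE : mZ = m.
  have : \int[P]_w (Z w - m) = 0.
    rewrite (lawZ _ msub); case: ifPn => [_|s0]; first by rewrite subrr.
    exact: normal_mean0.
  by rewrite RintegralB// Rintegral_prob_cst => /eqP; rewrite subr_eq0 => /eqP.
have iZ2 : P.-integrable setT (EFin \o (fun w => (Z w - m) ^+ 2)) := intZ _ msq isq.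
split => //; first by rewrite mZE.
move=> th; rewrite mZE (lawZ _ msq) (lawZ (fun x => cos (x + th))); last first.
  apply: measurableT_comp; first exact: continuous_measurable_fun (@continuous_cos R).
  exact: measurable_funD.
case: ifPn => [_|s0]; first by rewrite subrr expr0n/= mul0r oppr0 expR0 mulr1.
rewrite normal_variance0//.
have := normal_charfun m s0 1 (m + th); rewrite expr1n mulr1 => <-.
by apply: eq_Rintegral => x _; congr (cos _ * _); ring.
Qed.

End gaussian_rv_theory.

Definition coord_mean (R : realType) (T : nat) (pi : probability (T.-tuple R) R)
  (i : 'I_T) : R := \int[pi]_x tnth x i.

Section gaussian_law_theory.
Context (R : realType) (T : nat) (pi : probability (T.-tuple R) R) (sigma : R).
Hypothesis hpi : gaussian_law pi (sigma ^+ 2)%:M.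

Local Notation mean := (coord_mean pi).

Let gauss_coord (i : 'I_T) : gaussian_rv pi (fun x : T.-tuple R => tnth x i).
Proof.
have := hpi.1 1%N (fun=> i) (fun=> 1).
by under [X in gaussian_rv _ X]eq_fun do rewrite big_ord1 mul1r.
Qed.

Lemma gaussian_law_cov (i j : 'I_T) :
  \int[pi]_x ((tnth x i - mean i) * (tnth x j - mean j)) = sigma ^+ 2 *+ (i == j).
Proof.
have := hpi.2 i j; rewrite covariance.unlock !expectation.unlock mxE.
move=> /(congr1 fine)/= <-.
by [].
Qed.

(** The linear form is Gaussian by hypothesis. Its variance expands over pairs of coordinates, and
    the scalar covariance matrix leaves only the diagonal terms. *)
Lemma gaussian_law_charfun (a : 'I_T -> R) (th : R) :
  \int[pi]_x cos (\sum_i a i * tnth x i + th) =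
  cos (\sum_i a i * mean i + th) * expR (- (sigma ^+ 2 * (\sum_i a i ^+ 2) / 2)).
Proof.
have mt i : measurable_fun setT (fun x : T.-tuple R => tnth x i).
  by case: (gauss_coord i).
have it i : pi.-integrable setT (EFin \o (fun x : T.-tuple R => tnth x i)).
  by have [] := gaussian_rv_charfun (gauss_coord i).
have it2 i : pi.-integrable setT (EFin \o (fun x : T.-tuple R => (tnth x i - mean i) ^+ 2)).
  by have [] := gaussian_rv_charfun (gauss_coord i).
have ia i : pi.-integrable setT (EFin \o (fun x : T.-tuple R => a i * tnth x i)).
  by apply: eq_integrable (integrableZl measurableT (a i) (it i)).
have [_ _ ->] := gaussian_rv_charfun (hpi.1 T id a).
have mE : \int[pi]_w (\sum_(k < T) a k * tnth w k) = \sum_i a i * mean i.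
  by rewrite Rintegral_sum//; apply: eq_bigr => i _; rewrite RintegralZl.
rewrite mE; congr (_ * expR (- (_ / 2))).
have icov i j : pi.-integrable setT (EFin \o (fun x : T.-tuple R =>
    a i * a j * ((tnth x i - mean i) * (tnth x j - mean j)))).
  have msub k : measurable_fun setT (fun x : T.-tuple R => tnth x k - mean k).
    exact: measurable_funB.
  have h := integrableZl measurableT (a i * a j)
    (integrable_mul_sqr (msub i) (msub j) (it2 i) (it2 j)).
  by apply: eq_integrable h.
transitivity (\int[pi]_x \sum_i \sum_j
    (a i * a j * ((tnth x i - mean i) * (tnth x j - mean j)))).
  apply: eq_Rintegral => x _; rewrite -sumrB expr2 mulr_suml.
  apply: eq_bigr => i _; rewrite mulr_sumr; apply: eq_bigr => j _; ring.
rewrite Rintegral_sum; last by move=> i; apply: integrable_sum_EFin => j.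
rewrite mulr_sumr; apply: eq_bigr => i _.
rewrite Rintegral_sum// (bigD1 i)//= big1 ?addr0.
  rewrite RintegralZl ?gaussian_law_cov ?eqxx//; first by rewrite mulr1n; ring.
  by apply: integrable_mul_sqr => //; exact: measurable_funB.
move=> j ji; rewrite RintegralZl ?gaussian_law_cov ?(eq_sym i) ?(negbTE ji) ?mulr0//.
by apply: integrable_mul_sqr => //; exact: measurable_funB.
Qed.

End gaussian_law_theory.

(** * Joint law and characteristic function of the three attributes *)

Section iid_laws.
Context d dE (Om : measurableType d) (E : measurableType dE) (R : realType).
Variables (P : probability Om R) (pi : probability E R) (X Y W : {RV P >-> E}).
Hypothesis hiid : iid_draws pi X Y W.

Let PXA (A : set E) : measurable A -> P (X @^-1` A) = pi A.
Proof. by move=> mA; case: (hiid.1 A mA). Qed.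
Let PYA (A : set E) : measurable A -> P (Y @^-1` A) = pi A.
Proof. by move=> mA; case: (hiid.1 A mA). Qed.
Let PWA (A : set E) : measurable A -> P (W @^-1` A) = pi A.
Proof. by move=> mA; case: (hiid.1 A mA). Qed.

Let mYW : measurable_fun setT (fun w => (Y w, W w)).
Proof. exact: measurable_fun_pair. Qed.
Let mXYW : measurable_fun setT (fun w => (X w, (Y w, W w))).
Proof. exact: measurable_fun_pair. Qed.

Definition iid_triple : {mfun Om >-> (E * (E * E))%type} := mfun_Sub (mem_set mXYW).

(** Independence is given on boxes, whereas uniqueness of the outer product asks for [A] times an
    arbitrary measurable [C] in [E * E]. For fixed [A] both sides are measures in [C] which agree on
    boxes with the product of [mscale r pi] and [pi], where [r] is the real number [pi A];
    uniqueness of that inner product then identifies them. *)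
Lemma iid_triple_law (D : set (E * (E * E))) : measurable D ->
  distribution P iid_triple D = (pi \x (pi \x pi))%E D.
Proof.
move=> mD; apply/esym.
apply: (@product_measure_unique _ _ E (E * E)%type R pi ((pi \x pi)%E : probability _ _)
  (distribution P iid_triple)) => // A C mA mC.
have r0 : 0 <= fine (pi A) by exact/fine_ge0/measure_ge0.
pose r : {nonneg R} := NngNum r0.
have rE : (r%:num)%:E = pi A by rewrite /= fineK// fin_num_measure.
have mA' : measurable (X @^-1` A) by exact: measurable_funPTI.
pose PA : {measure set Om -> \bar R} := mrestr P mA'.
pose rvYW : {mfun Om >-> (E * E)%type} := mfun_Sub (mem_set mYW).
transitivity (pushforward PA rvYW C).
  rewrite /distribution/= /pushforward/= /PA /= /mrestr; congr (P _).
  by apply/seteqP; split=> w /= [].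
transitivity (mscale r (pi \x pi)%E C); last by rewrite /mscale/= -rE.
transitivity ((mscale r pi \x pi)%E C).
  apply/esym/product_measure_unique => // B F mB mF.
  transitivity (P (X @^-1` A) * P (Y @^-1` B) * P (W @^-1` F))%E.
    rewrite -hiid.2// /pushforward/= /PA /= /mrestr; congr (P _).
    by apply/seteqP; split=> w /=; [move=> [[]]|move=> [[]]].
  transitivity (pi A * pi B * pi F)%E; last by rewrite -rE.
  by congr (_ * _ * _)%E; [exact: PXA|exact: PYA|exact: PWA].
apply: product_measure_unique => // B F mB mF.
transitivity (r%:num%:E * (pi \x pi)%E (B `*` F))%E; first by [].
by rewrite product_measure1E// muleA.
Qed.

End iid_laws.

Section iid_charfun.
Context d (Om : measurableType d) (R : realType) (P : probability Om R).
Variables (T : nat) (pi : probability (T.-tuple R) R) (sigma : R).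
Hypothesis hpi : gaussian_law pi (sigma ^+ 2)%:M.
Variables (X Y W : {RV P >-> T.-tuple R}).
Hypothesis hiid : iid_draws pi X Y W.

Local Notation mean := (coord_mean pi).

Let mlin (a : 'I_T -> R) : measurable_fun setT (fun x : T.-tuple R => \sum_i a i * tnth x i).
Proof.
by apply: measurable_sum => i; apply: measurable_funM => //; exact: measurable_tnth.
Qed.

Let mcos : measurable_fun setT (@cos R).
Proof. exact: continuous_measurable_fun (@continuous_cos R). Qed.

(** Integrating out [W], [Y] and [X] in turn, each use of [gaussian_law_charfun] replaces the
    attribute by its mean inside the cosine and releases a Gaussian factor. The zero-sum condition
    makes the remaining argument 0. *)
Lemma iid_charfun (a b c : 'I_T -> R) : (forall i, a i + b i + c i = 0) ->
  \int[P]_w cos (\sum_i (a i * tnth (X w) i + b i * tnth (Y w) i + c i * tnth (W w) i)) =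
  expR (- (sigma ^+ 2 * (\sum_i (a i ^+ 2 + b i ^+ 2 + c i ^+ 2)) / 2)).
Proof.
move=> abc.
pose f (z : T.-tuple R * (T.-tuple R * T.-tuple R)) :=
  cos (\sum_i c i * tnth z.2.2 i + (\sum_i b i * tnth z.2.1 i + \sum_i a i * tnth z.1 i)).
have mf : measurable_fun setT f.
  apply: measurableT_comp => //; apply: measurable_funD.
    by apply: (measurableT_comp (mlin c)); apply: measurableT_comp.
  apply: measurable_funD.
    by apply: (measurableT_comp (mlin b)); apply: measurableT_comp.
  by apply: (measurableT_comp (mlin a)).
have fC z : `|f z| <= 1 by exact: cos_max.
transitivity (\int[P]_w f (iid_triple X Y W w)).
  apply: eq_Rintegral => w _; rewrite -[iid_triple X Y W w]/(X w, (Y w, W w)) /f/=.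
  by congr cos; rewrite !big_split/=; ring.
rewrite -Rintegral_law//.
pose pi2 : probability (T.-tuple R * T.-tuple R)%type R := (pi \x pi)%E.
rewrite [LHS](_ : _ = \int[(pi \x pi2)%E]_z f z); last first.
  congr fine; apply: eq_measure_integral => D mD _; exact: iid_triple_law.
rewrite (@Rfubini12 _ _ _ _ _ pi pi2 f 1)//.
have ib (h : T.-tuple R -> R) : measurable_fun setT h -> pi.-integrable setT (EFin \o (cos \o h)).
  move=> mh; apply: (@bounded_integrable _ _ _ _ _ 1).
    exact: measurableT_comp.
  by move=> x; exact: cos_max.
under eq_Rintegral => x _.
  rewrite (@Rfubini12 _ _ _ _ _ pi pi (fun z => f (x, z)) 1)//; last first.
    exact: measurableT_comp mf (pair1_measurable x).
  under eq_Rintegral => y _.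
    rewrite /f/= (gaussian_law_charfun hpi)// addrCA.
    over.
  rewrite RintegralZr//; last first.
    by apply: ib; apply: measurable_funD => //; exact: mlin.
  rewrite (gaussian_law_charfun hpi)//.
  rewrite (_ : \sum_i b i * mean i + (\sum_i c i * mean i + \sum_i a i * tnth x i) =
     \sum_i a i * tnth x i + (\sum_i b i * mean i + \sum_i c i * mean i)); last by ring.
  over.
rewrite RintegralZr//; last first.
  have i2 : pi.-integrable setT (EFin \o (cos \o
      (fun x => \sum_i a i * tnth x i + (\sum_i b i * mean i + \sum_i c i * mean i)))).
    by apply: ib; apply: measurable_funD => //; exact: mlin.
  exact: eq_integrable (integrableZr measurableT _ i2).
rewrite RintegralZr//; last first.
  by apply: ib; apply: measurable_funD => //; exact: mlin.
rewrite (gaussian_law_charfun hpi)//.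
have -> : \sum_i a i * mean i + (\sum_i b i * mean i + \sum_i c i * mean i) = 0.
  rewrite -!big_split/= big1// => i _.
  by rewrite addrA -!mulrDl abc mul0r.
rewrite cos0 mul1r -!expRD; congr expR.
rewrite !big_split/=; ring.
Qed.

End iid_charfun.

(** * Gaussian subordination *)

Section normal_prob_integrals.
Context (R : realType) (tau : R).
Hypothesis tau0 : tau != 0.
Notation mu := (@lebesgue_measure R).
Notation N := (normal_prob 0 tau : probability (measurableTypeR R) R).

Lemma Rintegral_normal_prob (f : R -> R) : measurable_fun setT f ->
  \int[N]_x f x = \int[mu]_x (f x * normal_pdf 0 tau x).
Proof.
move=> mf; apply: (@Rintegral_density _ _ R mu N (normal_pdf 0 tau)) => //.
- exact: measurable_normal_pdf.
- by move=> x; exact: normal_pdf_ge0.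
Qed.

Lemma normal_prob_charfun (t th : R) :
  \int[N]_x cos (t * x + th) = cos th * expR (- (tau ^+ 2 * t ^+ 2 / 2)).
Proof.
rewrite Rintegral_normal_prob; last first.
  apply: measurableT_comp; first exact: continuous_measurable_fun (@continuous_cos R).
  by apply: measurable_funD => //; exact: measurable_funM.
rewrite -(normal_charfun 0 tau0); apply: eq_Rintegral => x _.
by rewrite subr0.
Qed.

(** Completing the square: the integrand times the density is a constant multiple of the normal
    density with 1/s^2 = 1/tau^2 + 2a and mean b s^2. *)
Lemma normal_prob_expR_quadratic (a b : R) : 0 <= a ->
  \int[N]_x expR (- (a * x ^+ 2) + b * x) =
  (1 + 2 * a * tau ^+ 2) `^ (- 2^-1) *
    expR (b ^+ 2 * tau ^+ 2 / (2 * (1 + 2 * a * tau ^+ 2))).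
Proof.
move=> a0; set D := 1 + 2 * a * tau ^+ 2.
have tt : 0 < tau ^+ 2 by rewrite exprn_even_gt0.
have D0 : 0 < D by rewrite /D; nra.
rewrite Rintegral_normal_prob; last first.
  apply: measurableT_comp => //; apply: measurable_funD.
    by apply: measurableT_comp => //; apply: measurable_funM => //; exact: measurable_funX.
  exact: measurable_funM.
pose s := Num.sqrt (tau ^+ 2 / D).
have s2 : s ^+ 2 = tau ^+ 2 / D by rewrite sqr_sqrtr// divr_ge0// ltW.
have s0 : s != 0 by rewrite gt_eqF// sqrtr_gt0 divr_gt0.
pose m := b * s ^+ 2.
pose C := D `^ (- 2^-1) * expR (b ^+ 2 * tau ^+ 2 / (2 * D)).
transitivity (\int[mu]_x (C * normal_pdf m s x)).
  apply: eq_Rintegral => x _; rewrite !normal_pdfE//= /normal_fun /C.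
  have -> : normal_peak tau = D `^ (- 2^-1) * normal_peak s.
    rewrite /normal_peak powRN powR12_sqrt ?ltW// -invfM -sqrtrM ?ltW//.
    congr (Num.sqrt _)^-1; rewrite s2 -!mulrnAl; field.
    by rewrite gt_eqF.
  rewrite [LHS]mulrC -!mulrA; congr (_ * _); rewrite [RHS]mulrCA; congr (_ * _).
  rewrite -!expRD; congr expR; rewrite /m s2 subr0 /D; field.
  by rewrite tau0 -/D gt_eqF.
rewrite RintegralZl//; last exact: integrable_normal_pdf.
by rewrite /Rintegral integral_normal_pdf mulr1.
Qed.

End normal_prob_integrals.

Section gaussian_subordination.
Context d (Om : measurableType d) (R : realType) (P : probability Om R).
Variables (n : nat) (p q : nat -> Om -> R) (tau : R) (g : R -> R -> R).
Hypothesis tau0 : tau != 0.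
Hypotheses (mp : forall i, measurable_fun setT (p i))
           (mq : forall i, measurable_fun setT (q i)).
Notation N := (normal_prob 0 tau : probability (measurableTypeR R) R).
Hypothesis mg : measurable_fun setT (fun z : R * R => g z.1 z.2).
Hypothesis gC : forall x y, `|g x y| <= 1.
Hypothesis pqg : forall x y : nat -> R,
  \int[P]_w cos (\sum_(0 <= i < n) (x i * p i w + y i * q i w)) =
  \prod_(0 <= i < n) g (x i) (y i).

Let N2 : probability (measurableTypeR R * measurableTypeR R)%type R := (N \x N)%E.
Let I : R := \int[N2]_z g z.1 z.2.
Let E i w := expR (- (tau ^+ 2 / 2 * (p i w ^+ 2 + q i w ^+ 2))).

Let mcos : measurable_fun setT (@cos R).
Proof. exact: continuous_measurable_fun (@continuous_cos R). Qed.

(** Characteristic function of a pair of independent normal frequencies, with a phase. Read from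
    right to left at [a = p i w], [b = q i w], it replaces the factor [E i w] by an average of
    cosines. *)
Let cos_N2 (a b th : R) :
  \int[N2]_z cos (z.1 * a + (z.2 * b + th)) =
  expR (- (tau ^+ 2 / 2 * (a ^+ 2 + b ^+ 2))) * cos th.
Proof.
have m1 : measurable_fun setT
    (fun z : (measurableTypeR R * measurableTypeR R)%type => cos (z.1 * a + (z.2 * b + th))).
  apply: measurableT_comp => //; apply: measurable_funD.
    by apply: measurable_funM.
  by apply: measurable_funD => //; exact: measurable_funM.
rewrite (@Rfubini12 _ _ _ _ _ N N _ 1 m1); last by move=> z; exact: cos_max.
under eq_Rintegral => x _.
  rewrite (_ : (fun y => _) = (fun y => cos (b * y + (x * a + th)))); last first.
    by apply/funext => y /=; congr cos; ring.
  rewrite normal_prob_charfun//.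
  over.
rewrite RintegralZr//; last first.
  apply: (@bounded_integrable _ _ _ _ _ 1); last by move=> z; exact: cos_max.
  by apply: measurableT_comp => //; apply: measurable_funD => //; exact: measurable_funM.
rewrite (_ : (fun x => _) = (fun x => cos (a * x + th))); last first.
  by apply/funext => y /=; rewrite mulrC.
rewrite normal_prob_charfun// -[LHS]mulrA -expRD [LHS]mulrC; congr (expR _ * _); ring.
Qed.

Let mE i : measurable_fun setT (E i).
Proof.
apply: measurableT_comp => //; apply: measurableT_comp => //.
by apply: measurable_funM => //; apply: measurable_funD; exact: measurable_funX.
Qed.

Let E01 i w : 0 <= E i w <= 1.
Proof.
rewrite expR_ge0/= -expR0 ler_expR oppr_le0 mulr_ge0 ?addr_ge0 ?sqr_ge0//.
by rewrite divr_ge0// sqr_ge0.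
Qed.

Let prodE01 k w : 0 <= \prod_(0 <= i < k) E i w <= 1.
Proof.
apply: (big_ind (fun r : R => 0 <= r <= 1)) => //; first by rewrite ler01 lexx.
by move=> u v /andP[u0 u1] /andP[v0 v1]; rewrite mulr_ge0//= mulr_ile1.
Qed.

Let mprodE k : measurable_fun setT (fun w => \prod_(0 <= i < k) E i w).
Proof. by apply: measurable_prod => i _. Qed.

(* The first k coordinates carry the factors E, the others still a cosine; the
   step writes E k times the cosine as an average over a random frequency. *)
Lemma subordination_step k : (k <= n)%N -> forall x y : nat -> R,
  \int[P]_w (\prod_(0 <= i < k) E i w *
             cos (\sum_(k <= i < n) (x i * p i w + y i * q i w))) =
  I ^+ k * \prod_(k <= i < n) g (x i) (y i).
Proof.
elim: k => [_ x y|k IH kn x y].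
  by rewrite expr0 mul1r -pqg; apply: eq_Rintegral => w _; rewrite big_geq// mul1r.
pose S w := \sum_(k.+1 <= i < n) (x i * p i w + y i * q i w).
have mS : measurable_fun setT S.
  by apply: measurable_sum => i; apply: measurable_funD; exact: measurable_funM.
pose A w := \prod_(0 <= i < k) E i w.
pose f (wz : Om * (measurableTypeR R * measurableTypeR R)) :=
  A wz.1 * cos (wz.2.1 * p k wz.1 + (wz.2.2 * q k wz.1 + S wz.1)).
have mf : measurable_fun setT f.
  apply: measurable_funM; first exact: measurableT_comp (mprodE k) measurable_fst.
  apply: measurableT_comp => //; apply: measurable_funD.
    apply: measurable_funM; first exact: measurableT_comp measurable_fst measurable_snd.
    exact: measurableT_comp (mp k) measurable_fst.
  apply: measurable_funD; last exact: measurableT_comp mS measurable_fst.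
  apply: measurable_funM; first exact: measurableT_comp measurable_snd measurable_snd.
  exact: measurableT_comp (mq k) measurable_fst.
have fC wz : `|f wz| <= 1.
  rewrite /f normrM; have /andP[A0 A1] := prodE01 k wz.1.
  by rewrite mulr_ile1 ?cos_max// ger0_norm.
(* The factor [E k] becomes an average over a frequency pair [z]; after exchanging the integrals,
   [z] is fixed and plays the role of the frequencies of coordinate [k]. *)
transitivity (\int[P]_w \int[N2]_z f (w, z)).
  apply: eq_Rintegral => w _; rewrite /f/= RintegralZl//; last first.
    apply: (@bounded_integrable _ _ _ _ _ 1); last by move=> z; exact: cos_max.
    apply: measurableT_comp => //; apply: measurable_funD; first exact: measurable_funM.
    by apply: measurable_funD => //; exact: measurable_funM.
  by rewrite cos_N2 big_nat_recr//= -mulrA.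
rewrite (@Rfubini _ _ _ _ _ P N2 f 1)//.
transitivity (\int[N2]_z (I ^+ k * (g z.1 z.2 * \prod_(k.+1 <= i < n) g (x i) (y i)))).
  apply: eq_Rintegral => z _.
  (* The induction hypothesis is applied with frequency [z] at [k] and the given ones beyond; hence
     the statement is quantified over all frequency sequences. *)
  pose upd (u : nat -> R) (v : R) i := if i == k then v else u i.
  rewrite -[RHS](_ : I ^+ k * \prod_(k <= i < n) g (upd x z.1 i) (upd y z.2 i) = _); last first.
    rewrite big_ltn// /upd eqxx; congr (_ * (_ * _)).
    by apply: eq_big_nat => i /andP[ki _]; rewrite gtn_eqF.
  rewrite -IH; last exact: ltnW.
  apply: eq_Rintegral => w _; rewrite /f/=; congr (_ * cos _).
  rewrite [RHS]big_ltn// /upd eqxx addrA; congr (_ + _).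
  by apply: eq_big_nat => i /andP[ki _]; rewrite gtn_eqF.
have ig : N2.-integrable setT (EFin \o (fun z : measurableTypeR R * measurableTypeR R => g z.1 z.2)).
  by apply: (@bounded_integrable _ _ _ _ _ 1).
have igZ := integrableZr measurableT (\prod_(k.+1 <= i < n) g (x i) (y i)) ig.
by rewrite RintegralZl// RintegralZr// -/I exprS mulrA [_ * I]mulrC.
Qed.

Lemma gaussian_subordination :
  \int[P]_w expR (- (tau ^+ 2 / 2 * \sum_(0 <= i < n) (p i w ^+ 2 + q i w ^+ 2))) = I ^+ n.
Proof.
(* At [k = n] the cosine of an empty sum is 1, so any frequencies would do. *)
have := subordination_step (leqnn n) (fun=> 0) (fun=> 0).
rewrite [\prod_(n <= i < n) _]big_geq// mulr1 => <-; apply: eq_Rintegral => w _.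
by rewrite [X in cos X]big_geq// cos0 mulr1 mulr_sumr -sumrN expR_sum.
Qed.

End gaussian_subordination.

(** * Gaussian integrals of squared differences of attributes *)

Section gaussian_expectations.
Context d (Om : measurableType d) (R : realType) (P : probability Om R).
Variables (T : nat) (pi : probability (T.-tuple R) R) (sigma : R).
Hypothesis hpi : gaussian_law pi (sigma ^+ 2)%:M.
Variables (X Y W : {RV P >-> T.-tuple R}).
Hypothesis hiid : iid_draws pi X Y W.
Variable tau : R.
Hypothesis tau0 : tau != 0.
Notation N := (normal_prob 0 tau : probability (measurableTypeR R) R).

Let mnth (Z : {RV P >-> T.-tuple R}) i : measurable_fun setT (fun w => nth 0 (Z w) i).
Proof.
have [iT|Ti] := ltnP i T; last first.
  rewrite (_ : (fun w => _) = cst 0); first exact: measurable_cst.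
  by apply/funext => w; rewrite nth_default// size_tuple.
rewrite (_ : (fun w => _) = (fun x => tnth x (Ordinal iT)) \o Z).
  by apply: measurableT_comp => //; exact: measurable_tnth.
by apply/funext => w /=; rewrite (tnth_nth 0).
Qed.

(* The coefficient sums vanish, so the unknown mean of pi cancels. *)
Lemma iid_subordination (a1 a2 a3 b1 b2 b3 : R) (S : Om -> R) (g : R -> R -> R) :
  a1 + a2 + a3 = 0 -> b1 + b2 + b3 = 0 ->
  (forall w, S w = \sum_(i < T)
    ((a1 * tnth (X w) i + a2 * tnth (Y w) i + a3 * tnth (W w) i) ^+ 2 +
     (b1 * tnth (X w) i + b2 * tnth (Y w) i + b3 * tnth (W w) i) ^+ 2)) ->
  (forall x y, g x y = expR (- (sigma ^+ 2 / 2 * ((x * a1 + y * b1) ^+ 2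
     + (x * a2 + y * b2) ^+ 2 + (x * a3 + y * b3) ^+ 2)))) ->
  \int[P]_w expR (- (tau ^+ 2 / 2 * S w)) = (\int[N]_x \int[N]_y g x y) ^+ T.
Proof.
move=> a0 b0 SE gE.
have gC (x y : R) : `|g x y| <= 1.
  rewrite gE ger0_norm ?expR_ge0// -expR0 ler_expR oppr_le0.
  have := sqr_ge0 (x * a1 + y * b1); have := sqr_ge0 (x * a2 + y * b2).
  have := sqr_ge0 (x * a3 + y * b3); have := sqr_ge0 sigma.
  move=> h1 h2 h3 h4; rewrite mulr_ge0 ?divr_ge0//; lra.
have mg : measurable_fun setT (fun z : measurableTypeR R * measurableTypeR R => g z.1 z.2).
  have ml (a b : R) : measurable_fun setT
      (fun z : measurableTypeR R * measurableTypeR R => (z.1 * a + z.2 * b) ^+ 2).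
    by apply: measurable_funX; apply: measurable_funD; exact: measurable_funM.
  under eq_fun do rewrite gE.
  apply: measurableT_comp => //; apply: measurableT_comp => //.
  by apply: measurable_funM => //; apply: measurable_funD; [apply: measurable_funD|]; exact: ml.
pose p (i : nat) w : R := a1 * nth 0 (X w) i + a2 * nth 0 (Y w) i + a3 * nth 0 (W w) i.
pose q (i : nat) w : R := b1 * nth 0 (X w) i + b2 * nth 0 (Y w) i + b3 * nth 0 (W w) i.
have mlin (c1 c2 c3 : R) i : measurable_fun setT
    (fun w => c1 * nth 0 (X w) i + c2 * nth 0 (Y w) i + c3 * nth 0 (W w) i).
  by apply: measurable_funD; [apply: measurable_funD|]; exact: measurable_funM.
have pqg (x y : nat -> R) : \int[P]_w cos (\sum_(0 <= i < T) (x i * p i w + y i * q i w)) =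
    \prod_(0 <= i < T) g (x i) (y i).
  (* Regrouping by attribute: these are the coefficients of [X], [Y] and [W] in the cosine, and they
     inherit the zero sum. *)
  pose c a b (i : 'I_T) := x i * a + y i * b.
  have cE i : c a1 b1 i + c a2 b2 i + c a3 b3 i = 0.
    rewrite /c (_ : _ + _ = x i * (a1 + a2 + a3) + y i * (b1 + b2 + b3)); last by ring.
    by rewrite a0 b0 !mulr0 addr0.
  transitivity (\int[P]_w cos (\sum_i (c a1 b1 i * tnth (X w) i +
      c a2 b2 i * tnth (Y w) i + c a3 b3 i * tnth (W w) i))).
    apply: eq_Rintegral => w _; rewrite big_mkord; congr cos; apply: eq_bigr => i _.
    by rewrite /p /q /c !(tnth_nth 0); ring.
  rewrite (iid_charfun hpi hiid cE) big_mkord.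
  under [RHS]eq_bigr do rewrite gE.
  rewrite -expR_sum; congr expR; rewrite sumrN mulrAC mulr_sumr; congr (- _).
have := @gaussian_subordination _ Om R P T p q tau g tau0 (mlin _ _ _) (mlin _ _ _) mg gC pqg.
rewrite (@Rfubini12 _ _ _ _ _ N N (fun z => g z.1 z.2) 1)// => <-.
apply: eq_Rintegral => w _; congr (expR (- (_ * _))).
by rewrite SE big_mkord; apply: eq_bigr => i _; rewrite /p /q !(tnth_nth 0).
Qed.

Lemma powR_half_exp (x : R) : 0 <= x -> (x `^ (- 2^-1)) ^+ T = x `^ (- (T%:R / 2)).
Proof.
by move=> x0; rewrite -powR_mulrn ?powR_ge0// -powRrM; congr (_ `^ _); ring.
Qed.

Let tt : 0 < tau ^+ 2. Proof. by rewrite exprn_even_gt0. Qed.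
Let ss : 0 <= sigma ^+ 2. Proof. exact: sqr_ge0. Qed.

(** The case of a single difference of attributes: the second linear form is zero, so the second
    frequency integrates to 1. *)
Let one_dim : (\int[N]_x \int[N]_y expR (- (sigma ^+ 2 * x ^+ 2))) ^+ T =
  (1 + 2 * sigma ^+ 2 * tau ^+ 2) `^ (- (T%:R / 2)).
Proof.
under eq_Rintegral do rewrite Rintegral_prob_cst.
rewrite (_ : (fun x => _) = (fun x => expR (- (sigma ^+ 2 * x ^+ 2) + 0 * x))); last first.
  by apply/funext => x; rewrite mul0r addr0.
rewrite normal_prob_expR_quadratic// expr0n/= !mul0r expR0 mulr1 powR_half_exp//.
by nra.
Qed.

Lemma expectation_gauss_XY :
  \int[P]_w expR (- (tau ^+ 2 / 2 * \sum_(i < T) (tnth (X w) i - tnth (Y w) i) ^+ 2)) =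
  (1 + 2 * sigma ^+ 2 * tau ^+ 2) `^ (- (T%:R / 2)).
Proof.
rewrite -one_dim; apply: (@iid_subordination 1 (-1) 0 0 0 0) => [||w|x y].
- by ring.
- by ring.
- by apply: eq_bigr => i _; ring.
- by congr expR; field.
Qed.

Lemma expectation_gauss_YW :
  \int[P]_w expR (- (tau ^+ 2 / 2 * \sum_(i < T) (tnth (Y w) i - tnth (W w) i) ^+ 2)) =
  (1 + 2 * sigma ^+ 2 * tau ^+ 2) `^ (- (T%:R / 2)).
Proof.
rewrite -one_dim; apply: (@iid_subordination 0 1 (-1) 0 0 0) => [||w|x y].
- by ring.
- by ring.
- by apply: eq_bigr => i _; ring.
- by congr expR; field.
Qed.

(** Both differences involve [X] with opposite signs, hence the cross term in x^2 - xy + y^2. The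
    two frequencies are integrated out one after the other, each by completing the square. *)
Lemma expectation_gauss_XWYX :
  \int[P]_w expR (- (tau ^+ 2 / 2 * \sum_(i < T)
     ((tnth (X w) i - tnth (W w) i) ^+ 2 + (tnth (Y w) i - tnth (X w) i) ^+ 2))) =
  (1 + sigma ^+ 2 * tau ^+ 2) `^ (- (T%:R / 2)) *
  (1 + 3 * sigma ^+ 2 * tau ^+ 2) `^ (- (T%:R / 2)).
Proof.
rewrite (@iid_subordination 1 0 (-1) (-1) 1 0 _
  (fun x y => expR (- (sigma ^+ 2 * (x ^+ 2 - x * y + y ^+ 2))))); first last.
- by move=> x y; congr expR; field.
- by move=> w; apply: eq_bigr => i _; ring.
- by ring.
- by ring.
set u := sigma ^+ 2 * tau ^+ 2.
have u0 : 0 <= u by rewrite mulr_ge0// ltW.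
set D := 1 + 2 * sigma ^+ 2 * tau ^+ 2.
have DE : D = 1 + 2 * u by rewrite /D /u mulrA.
have D0 : 0 < D by rewrite DE; lra.
(* Coefficient of x^2 left after integrating out [y]. The two normalizations multiply to D (1 + 2 a'
   tau^2) = (1 + 2u)^2 - u^2 = (1 + u)(1 + 3u). *)
pose a' := sigma ^+ 2 - sigma ^+ 2 * u / (2 * D).
have a'0 : 0 <= a'.
  have -> : a' = sigma ^+ 2 * ((2 + 3 * u) / (2 * D)) by rewrite /a' DE; field; rewrite -DE gt_eqF.
  by rewrite mulr_ge0// divr_ge0; lra.
have mquad (a b : R) : measurable_fun setT (fun y : R => expR (- (a * y ^+ 2) + b * y)).
  apply: measurableT_comp => //; apply: measurable_funD; last exact: measurable_funM.
  by apply: measurableT_comp => //; apply: measurable_funM => //; exact: measurable_funX.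
have Da : 0 <= 1 + 2 * a' * tau ^+ 2.
  by rewrite addr_ge0// mulr_ge0 ?(ltW tt)// mulr_ge0.
under eq_Rintegral => x _.
  rewrite (_ : (fun y => _) = (fun y => expR (- (sigma ^+ 2 * x ^+ 2)) *
      expR (- (sigma ^+ 2 * y ^+ 2) + (sigma ^+ 2 * x) * y))); last first.
    by apply/funext => y; rewrite -expRD; congr expR; field.
  rewrite RintegralZl//; last first.
    apply: (@bounded_integrable _ _ _ _ _ (expR (sigma ^+ 2 * x ^+ 2 / 4))); first exact: mquad.
    move=> y; rewrite ger0_norm ?expR_ge0// ler_expR.
    by have := mulr_ge0 ss (sqr_ge0 (x / 2 - y)); lra.
  rewrite normal_prob_expR_quadratic// -/D mulrCA -expRD.
  rewrite (_ : _ + _ = - (a' * x ^+ 2) + 0 * x); last first.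
    by rewrite /a' /u DE; field; rewrite -DE gt_eqF.
  over.
rewrite RintegralZl//; last first.
  apply: (@bounded_integrable _ _ _ _ _ 1); first exact: mquad.
  move=> y; rewrite ger0_norm ?expR_ge0// -expR0 ler_expR mul0r addr0 oppr_le0.
  by rewrite mulr_ge0 ?sqr_ge0.
rewrite normal_prob_expR_quadratic// expr0n/= !mul0r expR0 mulr1 -powRM//; last exact: ltW.
rewrite powR_half_exp; last first.
  by rewrite mulr_ge0// ltW.
rewrite -powRM; last 2 first.
- by rewrite addr_ge0.
- by rewrite -mulrA -/u; lra.
congr (_ `^ _); rewrite /a' -[3 * _ * _]mulrA -/u.
rewrite DE /u; field.
by rewrite exprMn -/u -DE gt_eqF.
Qed.

End gaussian_expectations.

(** * The Matern function as an inverse-gamma mixture *)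

Section exponential_substitution.
Context (R : realType).
Notation mu := (@lebesgue_measure R).

(** The substitution is made on compact intervals, whose images under t -> a e^t exhaust the
    positive half-line; monotone convergence passes to the limit on both sides, even when the
    integrals are infinite. *)
Lemma ge0_integration_by_substitution_expR (G : R -> R) (a : R) : 0 < a ->
  (forall x, 0 < x -> 0 <= G x) -> {in `]0, +oo[, continuous G} ->
  measurable_fun setT G ->
  (\int[mu]_(x in `]0%R, +oo[) (G x)%:E =
   \int[mu]_t (G (a * expR t) * (a * expR t))%:E)%E.
Proof.
move=> a0 G0 cG mG.
pose F (t : R) := a * expR t.
have dF (t : R) : is_derive t (1:R) F (F t).
  rewrite /F; apply: is_derive_eq; rewrite /GRing.scale/=; ring.
have F'E : derive1 F = F.
  by apply/funext => t; rewrite derive1E; exact: (@derive_val _ _ _ _ _ _ _ (dF t)).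
have cF : continuous F.
  move=> x; apply/differentiable_continuous/derivable1_diffP.
  exact: (@ex_derive _ _ _ _ _ _ _ (dF x)).
have F0 t : 0 < F t by rewrite mulr_gt0// expR_gt0.
have iF : {homo F : x y / x < y}.
  by move=> x y xy; rewrite /F ltr_pM2l// ltr_expR.
pose D (n : nat) : set R := `[- n.+1%:R, n.+1%:R]%classic.
pose C (n : nat) : set R := `[F (- n.+1%:R), F n.+1%:R]%classic.
have step n : (\int[mu]_(x in C n) (G x)%:E = \int[mu]_(t in D n) (G (F t) * F t)%:E)%E.
  rewrite /C integration_by_substitution_increasing//.
  - by apply: eq_integral => t _; rewrite F'E.
  - by rewrite (@le_trans _ _ 0)// oppr_le0.
  - by move=> x y _ _; exact: iF.
  - by rewrite F'E => x _; exact: cF.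
  - rewrite F'E; apply/cvg_ex; exists (F (- n.+1%:R)).
    by apply: cvg_at_right_filter; exact: cF.
  - rewrite F'E; apply/cvg_ex; exists (F n.+1%:R).
    by apply: cvg_at_left_filter; exact: cF.
  - split => [x _||]; first exact: (@ex_derive _ _ _ _ _ _ _ (dF x)).
    + by apply: cvg_at_right_filter; exact: cF.
    + by apply: cvg_at_left_filter; exact: cF.
  - apply: continuous_in_subspaceT => x; rewrite inE/= in_itv/= => /andP[Fx _].
    by apply: cG; rewrite in_itv/= andbT (lt_le_trans (F0 _) Fx).
have UD : \bigcup_n D n = setT.
  apply/seteqP; split => // x _.
  exists (Num.truncn `|x|) => //; rewrite /D/= in_itv/= -ler_norml.
  by apply/ltW/truncnS_gt.
have UC : \bigcup_n C n = `]0, +oo[%classic.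
  apply/seteqP; split => x.
    by move=> [n _]; rewrite /C/= !in_itv/= andbT => /andP[h _]; exact: lt_le_trans h.
  rewrite /= in_itv/= andbT => x0.
  have [t tx] : exists t, F t = x.
    by exists (ln (x / a)); rewrite /F lnK ?posrE ?divr_gt0// mulrC divfK// gt_eqF.
  have : (\bigcup_n D n) t by rewrite UD.
  move=> [n _]; rewrite /D/= in_itv/= => /andP[h1 h2]; exists n => //.
  rewrite /C/= in_itv/= -tx /F !ler_pM2l// !ler_expR.
  by rewrite h1.
have mH : measurable_fun setT (fun t => (G (F t) * F t)%:E).
  apply/measurable_EFinP; apply: measurable_funM.
    by apply: measurableT_comp => //; exact: continuous_measurable_fun.
  exact: continuous_measurable_fun.
have lim1 : (\int[mu]_(x in C n) (G x)%:E)%E @[n --> \oo] -->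
    (\int[mu]_(x in \bigcup_n C n) (G x)%:E)%E.
  apply: ge0_nondecreasing_set_cvg_integral => //.
  - move=> m n mn; apply/subsetPset; apply: subset_itv; rewrite bnd_simp /F ler_pM2l// ler_expR ?lerN2 ler_nat//.
  - by move=> n; exact: measurable_itv.
  - by move=> n; exact/measurable_funTS/measurable_EFinP.
  - by move=> n x; rewrite /C/= in_itv/= => /andP[h _]; rewrite lee_fin G0// (lt_le_trans _ h).
have lim2 : (\int[mu]_(t in D n) (G (F t) * F t)%:E)%E @[n --> \oo] -->
    (\int[mu]_(t in \bigcup_n D n) (G (F t) * F t)%:E)%E.
  apply: ge0_nondecreasing_set_cvg_integral => //.
  - move=> m n mn; apply/subsetPset; apply: subset_itv; rewrite bnd_simp ?lerN2 ler_nat//.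
  - by move=> n; exact: measurable_itv.
  - by move=> n; exact: measurable_funTS.
  - by move=> n x _; rewrite lee_fin mulr_ge0 ?G0// ltW.
move: lim1; under eq_fun do rewrite step.
by rewrite UC => lim1; rewrite -(cvg_unique _ lim2 lim1)// UD.
Qed.

(** Meant for an integrand whose only non-even factor is exp(- nu t): folding at 0 creates the
    cosh(nu t) of [besselK]. *)
Lemma ge0_integralT_fold (H : R -> R) : (forall x, 0 <= H x) -> continuous H ->
  (\int[mu]_t (H t)%:E = \int[mu]_(t in `]0%R, +oo[) (H t + H (- t))%:E)%E.
Proof.
move=> H0 cH.
have mH : measurable_fun setT H by exact: continuous_measurable_fun.
have mHN : measurable_fun setT (fun t : R => H (- t)) by exact: measurableT_comp.
rewrite (_ : [set: _] = `]-oo, 0%R] `|` `]0%R, +oo[); last first.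
  by apply/seteqP; split => // x _ /=; rewrite !in_itv/= andbT; case: (leP x 0) => _; [left|right].
rewrite ge0_integral_setU//=; last 3 first.
- exact/measurable_funTS/measurable_EFinP.
- by move=> x _; rewrite lee_fin.
- by apply/disj_setPS => x [] /=; rewrite !in_itv/= andbT => x0 /lt_le_trans /(_ x0); rewrite ltxx.
have := @ge0_integration_by_substitutionNy R H 0; rewrite oppr0 => ->; last 2 first.
- exact: continuous_subspaceT.
- by move=> x _; exact: H0.
rewrite -integral_itv_obnd_cbnd; last first.
  by apply/measurable_funTS; exact/measurable_EFinP.
rewrite -ge0_integralD//=; last 4 first.
- by move=> x _; rewrite lee_fin.
- by apply/measurable_funTS; exact/measurable_EFinP.
- by move=> x _; rewrite lee_fin.
- by apply/measurable_funTS; exact/measurable_EFinP.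
by apply: eq_integral => x _; rewrite -EFinD addrC.
Qed.

End exponential_substitution.

Section matern_mixture.
Context (R : realType).
Notation mu := (@lebesgue_measure R).

(** An infinite integral causes no trouble: for [r > 0] it stays infinite and [fine] sends both
    sides to 0, and for [r = 0] both sides are 0. *)
Lemma ge0_RintegralZl d (T : measurableType d) (m : {measure set T -> \bar R})
    (D : set T) (f : T -> R) (r : R) : measurable D -> measurable_fun D f ->
  (forall x, D x -> 0 <= f x) -> 0 <= r ->
  \int[m]_(x in D) (r * f x) = r * \int[m]_(x in D) f x.
Proof.
move=> mD mf f0 r0; rewrite /Rintegral; under eq_integral do rewrite EFinM.
rewrite ge0_integralZl//; last by exact/measurable_EFinP.
have : (0 <= \int[m]_(x in D) (f x)%:E)%E by apply: integral_ge0 => x Dx; rewrite lee_fin f0.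
case: (\int[m]_(x in D) (f x)%:E)%E => [x _|_|]//=.
have [->|rn0] := eqVneq r 0; first by rewrite mul0e mul0r.
by rewrite gt0_muley ?lte_fin ?lt_neqAle 1?eq_sym ?rn0// mulr0.
Qed.

Lemma gammaF_ge0 (a : R) : 0 <= gammaF a.
Proof. by apply: Rintegral_ge0 => t _; rewrite mulr_ge0 ?powR_ge0 ?expR_ge0. Qed.

(* The inverse is a power because [powR] is known to be measurable. *)
Let bk (nu k x : R) := x `^ (- (nu + 1)) * expR (- (nu * x `^ (-1)) - k * x).

Let mbk nu k : measurable_fun setT (bk nu k).
Proof.
apply: measurable_funM; first exact: measurable_powR.
apply: measurableT_comp => //; apply: measurable_funB; last exact: measurable_funM.
apply: measurableT_comp => //; apply: measurable_funM => //; exact: measurable_powR.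
Qed.

Lemma measurable_inv_gamma_pdf (a b : R) : measurable_fun setT (inv_gamma_pdf a b).
Proof.
rewrite (_ : inv_gamma_pdf a b = fun v => if 0 < v then
  b `^ a / gammaF a * v `^ (- (a + 1)) * expR (- (b * v `^ (-1))) else 0); last first.
  by apply/funext => v; rewrite /inv_gamma_pdf; case: ifPn => // v0; rewrite powR_inv1// ltW.
apply: measurable_fun_ifT => //.
  exact: measurable_fun_ltr.
apply: measurable_funM.
  by apply: measurable_funM => //; exact: measurable_powR.
apply: measurableT_comp => //; apply: measurableT_comp => //.
by apply: measurable_funM => //; exact: measurable_powR.
Qed.

Lemma inv_gamma_pdf_ge0 (a b x : R) : 0 <= inv_gamma_pdf a b x.
Proof.
rewrite /inv_gamma_pdf; case: ifP => // _.
by rewrite mulr_ge0 ?expR_ge0// mulr_ge0 ?powR_ge0// divr_ge0 ?powR_ge0 ?gammaF_ge0.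
Qed.

Let powR_continuous (p x : R) : 0 < x -> {for x, continuous (fun y : R => y `^ p)}.
Proof.
move=> x0; apply/differentiable_continuous/derivable1_diffP.
by apply: derivable_powR; rewrite in_itv/= andbT.
Qed.

Lemma bessel_mixture (nu u : R) : 0 < nu -> 0 < u ->
  \int[mu]_(x in `]0, +oo[) bk nu (u ^+ 2 / (4 * nu)) x =
  (u / (2 * nu)) `^ nu * (2 * besselK nu u).
Proof.
move=> nu0 u0; set k := u ^+ 2 / (4 * nu).
(* This scale balances the two exponents, nu / a = k a = u / 2, so that they combine into u cosh
   t. *)
pose a := 2 * nu / u.
have a0 : 0 < a by rewrite divr_gt0// mulr_gt0.
(* The constant a^(- nu) that remains once the Jacobian a e^t cancels one power of x. *)
pose c := (u / (2 * nu)) `^ nu.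
have c0 : 0 <= c by rewrite powR_ge0.
pose H (t : R) := c * (expR (- (u * cosh t)) * expR (- (nu * t))).
have H0 t : 0 <= H t by rewrite !mulr_ge0 ?expR_ge0.
have HE t : bk nu k (a * expR t) * (a * expR t) = H t.
  pose al := ln a; have aE : a = expR al by rewrite /al lnK.
  have cE : c = expR (- (al * nu)).
    rewrite /c (_ : u / (2 * nu) = expR (- al)); last first.
      by rewrite expRN -aE /a invf_div.
    by rewrite -expRM mulNr.
  rewrite /H cE /bk powR_inv1; last by rewrite mulr_ge0 ?expR_ge0 ?ltW.
  rewrite [in X in X `^ _]aE [X in _ * X = _](_ : _ = expR (al + t)); last by rewrite aE expRD.
  rewrite -[in X in X `^ _]expRD -expRM -!expRD; congr expR.
  have -> : - (nu * (a * expR t)^-1) - k * (a * expR t) = - (u * cosh t).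
    rewrite /cosh /k /a expRN; field.
    by rewrite !gt_eqF ?expR_gt0.
  ring.
have cH : continuous H.
  move=> t; apply: cvgM; first exact: cvg_cst.
  apply: cvgM.
    apply: (cvg_comp _ expR); last exact: continuous_expR.
    apply: (@cvgN _ R^o); apply: cvgM; first exact: cvg_cst.
    apply: cvgM; last exact: cvg_cst.
    apply: (@cvgD _ R^o); first exact: continuous_expR.
    apply: (cvg_comp _ expR); last exact: continuous_expR.
    by apply: (@cvgN _ R^o); exact: cvg_id.
  apply: (cvg_comp _ expR); last exact: continuous_expR.
  by apply: (@cvgN _ R^o); apply: cvgM; [exact: cvg_cst|exact: cvg_id].
have mcosh (v : R) : measurable_fun setT (fun t : R => cosh (v * t)).
  rewrite /cosh; apply: measurable_funM => //; apply: measurable_funD.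
    by apply: measurableT_comp => //; exact: measurable_funM.
  by apply: measurableT_comp => //; apply: measurableT_comp => //; exact: measurable_funM.
have mK : measurable_fun setT (fun t : R => expR (- (u * cosh t)) * cosh (nu * t)).
  apply: measurable_funM => //; apply: measurableT_comp => //; apply: measurableT_comp => //.
  by apply: measurable_funM => //; have := mcosh 1; under eq_fun do rewrite mul1r.
rewrite {1}/Rintegral (@ge0_integration_by_substitution_expR R (bk nu k) a)//; last 2 first.
- by move=> x x0; rewrite mulr_ge0 ?powR_ge0 ?expR_ge0.
- move=> x; rewrite in_itv/= andbT => x0; apply: cvgM; first exact: powR_continuous.
  apply: (cvg_comp _ expR); last exact: continuous_expR.
  apply: (@cvgB _ R^o); last by apply: cvgM; [exact: cvg_cst|exact: cvg_id].
  apply: (@cvgN _ R^o); apply: cvgM; [exact: cvg_cst|exact: powR_continuous].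
under eq_integral do rewrite HE.
rewrite ge0_integralT_fold//.
rewrite -/(Rintegral mu `]0, +oo[ (fun t => H t + H (- t))).
transitivity (\int[mu]_(t in `]0, +oo[) (c * 2 * (expR (- (u * cosh t)) * cosh (nu * t)))).
  apply: eq_Rintegral => t _; rewrite /H.
  have -> : cosh (- t) = cosh t by rewrite /cosh opprK addrC.
  by rewrite /(cosh (nu * t)) mulrN opprK; field.
rewrite ge0_RintegralZl//.
- by rewrite /besselK mulrA.
- exact: measurable_funTS.
- by move=> x _; rewrite mulr_ge0 ?expR_ge0// divr_ge0// addr_ge0 ?expR_ge0.
- by rewrite mulr_ge0.
Qed.

(** The right side is the Laplace transform of the inverse gamma density at s^2/(2 l^2) = u^2/(4
    nu), which [bessel_mixture] evaluates. The constants agree because 2 nu^nu (u/(2 nu))^nu = 2^(1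
    - nu) u^nu. *)
Lemma matern_mixture d (Om : measurableType d) (P : probability Om R)
    (V : {RV P >-> R}) (nu l s : R) : 0 < nu -> 0 < l -> 0 <= s ->
  inv_gamma_distributed nu nu V ->
  matern l nu s = \int[P]_w expR (- (V w / (2 * l ^+ 2) * s ^+ 2)).
Proof.
move=> nu0 l0 s0 hV; rewrite /matern; have [->|sn0] := eqVneq s 0.
  under eq_Rintegral do rewrite expr0n/= mulr0 oppr0 expR0.
  by rewrite Rintegral_prob_cst.
have {sn0}s0 : 0 < s by rewrite lt_neqAle eq_sym sn0.
set u := Num.sqrt (2 * nu) * s / l.
have nn : 0 < 2 * nu by rewrite mulr_gt0.
have u0 : 0 < u by rewrite divr_gt0// mulr_gt0// sqrtr_gt0.
have uE : u ^+ 2 / (4 * nu) = s ^+ 2 / (2 * l ^+ 2).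
  by rewrite /u expr_div_n exprMn sqr_sqrtr ?ltW//; field; rewrite !gt_eqF.
pose f (x : R) := expR (- (x / (2 * l ^+ 2) * s ^+ 2)).
have mf : measurable_fun setT f.
  by apply: measurableT_comp => //; apply: measurableT_comp => //; apply: measurable_funM => //; exact: measurable_funM.
pose V' : {mfun Om >-> measurableTypeR R} :=
  @mfun_Sub _ _ Om (measurableTypeR R) V (mem_set (measurable_funP V)).
transitivity (\int[distribution P V']_x f x); last exact: (Rintegral_law P V' mf).
rewrite (@Rintegral_density _ _ R mu (distribution P V') (inv_gamma_pdf nu nu)
  (measurable_inv_gamma_pdf nu nu) (inv_gamma_pdf_ge0 nu nu) hV f mf).
pose C := nu `^ nu / gammaF nu.
transitivity (\int[mu]_(x in `]0, +oo[) (C * bk nu (u ^+ 2 / (4 * nu)) x)).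
  rewrite ge0_RintegralZl//; last 3 first.
  - apply: measurable_funTS; exact: mbk.
  - by move=> x _; rewrite mulr_ge0 ?powR_ge0 ?expR_ge0.
  - by rewrite divr_ge0 ?powR_ge0 ?gammaF_ge0.
  rewrite bessel_mixture// /C powRM ?invr_ge0 ?(ltW u0) ?(ltW nn)//.
  rewrite -[(2 * nu)^-1]powR_inv1 ?(ltW nn)// -powRrM mulN1r powRN powRM ?(ltW nu0)//.
  have -> : 2 `^ (1 - nu) = 2 / 2 `^ nu :> R.
    by rewrite powRB ?powRr1//; apply/implyP => _; rewrite pnatr_eq0.
  have n0 : nu `^ nu != 0 by rewrite gt_eqF// powR_gt0.
  have t0 : 2 `^ nu != 0 :> R by rewrite gt_eqF// powR_gt0.
  move: (gammaF nu)^-1 (besselK nu u) (u `^ nu) => g K un.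
  by field; rewrite n0 t0.
rewrite Rintegral_mkcond; apply: eq_Rintegral => x _.
rewrite patchE; case: ifPn => [|].
  rewrite inE/= in_itv/= andbT => x0.
  rewrite /inv_gamma_pdf x0 /f /bk powR_inv1 ?ltW// uE -/C.
  transitivity (C * (x `^ (- (nu + 1)) *
      (expR (- (nu / x)) * expR (- (x / (2 * l ^+ 2) * s ^+ 2))))); last by ring.
  rewrite -expRD; congr (_ * (_ * expR _)); ring.
rewrite notin_setE/= in_itv/= andbT => /negP x0.
by rewrite /inv_gamma_pdf (negbTE x0) mulr0.
Qed.

Lemma inv_gamma_gt0 d (Om : measurableType d) (P : probability Om R)
    (V : {RV P >-> R}) (a b : R) : inv_gamma_distributed a b V ->
  {ae P, forall w, 0 < V w}.
Proof.
move=> hV; exists (V @^-1` `]-oo, 0]); split.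
- by apply: measurable_funPTI; exact: measurable_itv.
- have := hV `]-oo, 0]%classic (measurable_itv _); rewrite /distribution/= /pushforward/= => ->.
  rewrite integral0_eq// => x /=; rewrite in_itv/= => x0.
  by rewrite /inv_gamma_pdf ltNge x0.
- move=> w /= /negP; rewrite -leNgt in_itv/= => ?; by [].
Qed.

End matern_mixture.

(** * The skew process *)

Section covariance_fubini.
Context d1 d2 (T1 : measurableType d1) (T2 : measurableType d2) (R : realType).
Variables (P1 : probability T1 R) (P2 : probability T2 R).

Lemma measurable_fun_integral1 (f : T1 * T2 -> \bar R) : measurable_fun setT f ->
  measurable_fun setT (fun y => \int[P1]_x f (x, y))%E.
Proof.
move=> mf.
rewrite (_ : (fun y => _) =
    (fun y => fubini_G P1 f^\+ y - fubini_G P1 f^\- y))%E; last first.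
  apply/funext => y; rewrite integralE /fubini_G.
  by congr (_ - _)%E; apply: eq_integral => x _; rewrite ?funeposE ?funenegE.
apply: emeasurable_funB; apply: measurable_fun_fubini_tonelli_G => //.
- exact: measurable_funepos.
- exact: measurable_funeneg.
Qed.

Variables M N : T1 * T2 -> R.
Hypotheses (mM : measurable_fun setT M) (mN : measurable_fun setT N).
Hypothesis M2 : (P1 \x P2)%E.-integrable setT (EFin \o (fun z => M z ^+ 2)).
Hypothesis N2 : (P1 \x P2)%E.-integrable setT (EFin \o (fun z => N z ^+ 2)).
Hypothesis M0 : {ae P2, forall y, \int[P1]_x M (x, y) = 0}.
Hypothesis N0 : {ae P2, forall y, \int[P1]_x N (x, y) = 0}.

Let mmean (L : T1 * T2 -> R) : measurable_fun setT L ->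
  measurable_fun setT (fun y => fine 'E_P1[fun x => L (x, y)]%E).
Proof.
move=> mL; rewrite expectation.unlock; apply: measurableT_comp => //.
by apply: (measurable_fun_integral1 (f := EFin \o L)); exact/measurable_EFinP.
Qed.

(** Where the conditional means vanish, the centred product is [M * N], and Fubini exchanges the
    integrals. The means are zero only almost everywhere, so the centred integrand must first be
    shown measurable, which is the purpose of [mmean]. *)
Lemma integral_covariance :
  (\int[P2]_y covariance P1 (fun x => M (x, y)) (fun x => N (x, y)) =
   \int[P1]_x \int[P2]_y (M (x, y) * N (x, y))%:E)%E.
Proof.
have iMN : (P1 \x P2)%E.-integrable setT (EFin \o (fun z => M z * N z)).
  exact: integrable_mul_sqr.
rewrite (Fubini iMN)/=.
pose c (L : T1 * T2 -> R) (y : T2) := fine 'E_P1[fun x => L (x, y)]%E.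
have covE y : covariance P1 (fun x => M (x, y)) (fun x => N (x, y)) =
    (\int[P1]_x ((M (x, y) - c M y) * (N (x, y) - c N y))%:E)%E.
  by rewrite covariance.unlock /c expectation.unlock.
under eq_integral do rewrite covE.
apply: ae_eq_integral => //.
- apply: (measurable_fun_integral1 (f := fun z =>
    ((M z - c M z.2) * (N z - c N z.2))%:E)).
  apply/measurable_EFinP; apply: measurable_funM; apply: measurable_funB => //.
  + exact: measurableT_comp (mmean mM) measurable_snd.
  + exact: measurableT_comp (mmean mN) measurable_snd.
- by apply: (measurable_fun_integral1 (f := EFin \o (fun z => M z * N z))); exact: measurable_int iMN.
- have fE (L : T1 * T2 -> R) y : \int[P1]_x L (x, y) = 0 -> c L y = 0.
    by rewrite /c expectation.unlock.
  apply: filterS2 M0 N0 => y My Ny _ /=.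
  rewrite (fE M y My) (fE N y Ny).
  by apply: eq_integral => x _ /=; rewrite !subr0.
Qed.

End covariance_fubini.

Section exchangeable_mean.
Context d (T : measurableType d) dE (E : measurableType dE) (R : realType).
Variables (P : probability T R) (pi : probability E R) (X Y : {mfun T >-> E}).
Hypothesis XY : forall A B : set E, measurable A -> measurable B ->
  P ((X @^-1` A) `&` (Y @^-1` B)) = (pi A * pi B)%E.

Let mpair (Z Z' : {mfun T >-> E}) : measurable_fun setT (fun w => (Z w, Z' w)).
Proof. exact: measurable_fun_pair. Qed.

Lemma exchangeable_skew_mean (f : E * E -> R) : measurable_fun setT f ->
  (forall x y, f (y, x) = - f (x, y)) ->
  P.-integrable setT (EFin \o (fun w => f (X w, Y w))) ->
  \int[P]_w f (X w, Y w) = 0.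
Proof.
move=> mf skewf intf.
pose XYp : {mfun T >-> (E * E)%type} := mfun_Sub (mem_set (mpair X Y)).
pose YXp : {mfun T >-> (E * E)%type} := mfun_Sub (mem_set (mpair Y X)).
have lXY D : measurable D -> distribution P XYp D = (pi \x pi)%E D.
  by move=> mD; apply/esym/product_measure_unique.
have lYX D : measurable D -> distribution P YXp D = (pi \x pi)%E D.
  move=> mD; apply/esym/product_measure_unique => // A B mA mB.
  transitivity (P ((X @^-1` B) `&` (Y @^-1` A))); first by rewrite setIC.
  by rewrite muleC; exact: XY.
have h : \int[P]_w f (X w, Y w) = \int[P]_w f (Y w, X w).
  rewrite -[LHS](Rintegral_law P XYp mf) -[RHS](Rintegral_law P YXp mf).
  by congr fine; apply: eq_measure_integral => D mD _; exact: etrans (lXY D mD) (esym (lYX D mD)).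
have : \int[P]_w f (Y w, X w) = - \int[P]_w f (X w, Y w).
  rewrite -mulN1r -RintegralZl//; apply: eq_Rintegral => w _.
  by rewrite skewf mulN1r.
rewrite -h => h2; lra.
Qed.

End exchangeable_mean.

(** * Second moments of the skew part in terms of the kernel *)

Section skew_moments.
Context d (Om : measurableType d) (R : realType) (PF : probability Om R).
Context dE (E : measurableType dE).
Variables (U : E * E -> Om -> R) (K : E * E -> E * E -> R).
Hypothesis mU : forall z, measurable_fun setT (U z).
Hypothesis hUcov : forall z z', covariance PF (U z) (U z') = (K z z')%:E.
Hypothesis hFmean : forall x y, ('E_PF[skew_part U x y] = 0)%E.

(** [fine] gives a real centring constant before [U z] is known to be integrable; this is how
    [covariance] centres too. Integrability follows in [iU]. *)
Let m z := fine 'E_PF[U z]%E.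
Let c z w := U z w - m z.

Let mc z : measurable_fun setT (c z).
Proof. exact: measurable_funB. Qed.

Let covE z z' : (\int[PF]_w (c z w * c z' w)%:E = (K z z')%:E)%E.
Proof. by rewrite -hUcov covariance.unlock /c /m expectation.unlock. Qed.

(** Square integrability is read off from the finite value of the covariance of [U z] with
    itself. *)
Let c2 z : PF.-integrable setT (EFin \o (fun w => c z w ^+ 2)).
Proof.
apply/integrableP; split; first by apply/measurable_EFinP; exact: measurable_funX.
under eq_integral do rewrite /= ger0_norm ?sqr_ge0// expr2.
by rewrite covE ltry.
Qed.

Let cc z z' : PF.-integrable setT (EFin \o (fun w => c z w * c z' w)).
Proof. exact: integrable_mul_sqr. Qed.

Let icst (r : R) : PF.-integrable setT (EFin \o (fun=> r)).
Proof. by apply: (@bounded_integrable _ _ _ _ _ `|r|). Qed.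

Let ic z : PF.-integrable setT (EFin \o c z).
Proof. exact: integrable_of_sqr. Qed.

Let iU z : PF.-integrable setT (EFin \o U z).
Proof.
apply: eq_integrable (integrableD measurableT (ic z) (icst (m z))) => // w _ /=.
by rewrite -EFinD subrK.
Qed.

(* F is centred, so it is also the skew part of the centred process c. *)
Let m_sym x y : m (x, y) = m (y, x).
Proof.
have := hFmean x y; rewrite expectation.unlock /skew_part.
under eq_integral do rewrite EFinB.
rewrite (integralB measurableT (iU (x, y)) (iU (y, x))).
have fin z : (\int[PF]_w (U z w)%:E)%E \is a fin_num := integrable_fin_num measurableT (iU z).
have mE z : m z = fine (\int[PF]_w (U z w)%:E)%E by rewrite /m expectation.unlock.
rewrite !mE -(fineK (fin (x, y))) -(fineK (fin (y, x))) -EFinB => /(congr1 fine)/= /eqP.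
by rewrite subr_eq0 => /eqP ->.
Qed.

Let skewE x y w : skew_part U x y w = c (x, y) w - c (y, x) w.
Proof. by rewrite /skew_part /c m_sym; ring. Qed.

Lemma skew_part_moment x y x' y' :
  (\int[PF]_w (skew_part U x y w * skew_part U x' y' w)%:E)%E =
  (K (x, y) (x', y') - K (x, y) (y', x') - K (y, x) (x', y') + K (y, x) (y', x'))%:E.
Proof.
transitivity (\int[PF]_w ((((c (x, y) w * c (x', y') w)%:E - (c (x, y) w * c (y', x') w)%:E)
   - (c (y, x) w * c (x', y') w)%:E) + (c (y, x) w * c (y', x') w)%:E))%E.
  by apply: eq_integral => w _; rewrite -!EFinB -EFinD !skewE; congr EFin; ring.
have i1 := integrableB measurableT (cc (x, y) (x', y')) (cc (x, y) (y', x')).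
have i2 := integrableB measurableT i1 (cc (y, x) (x', y')).
rewrite (integralD measurableT i2 (cc (y, x) (y', x'))).
rewrite (integralB measurableT i1 (cc (y, x) (x', y'))).
rewrite (integralB measurableT (cc (x, y) (x', y')) (cc (x, y) (y', x'))).
by rewrite !covE.
Qed.

End skew_moments.

Definition sqdist (R : realType) (T : nat) (x y : T.-tuple R) : R :=
  \sum_(i < T) (tnth x i - tnth y i) ^+ 2.

Section sqdist_theory.
Context (R : realType) (T : nat).
Implicit Types x y : T.-tuple R.

Lemma sqdist_ge0 x y : 0 <= sqdist x y.
Proof. by apply: sumr_ge0 => i _; exact: sqr_ge0. Qed.

Lemma sqdistC x y : sqdist x y = sqdist y x.
Proof. by apply: eq_bigr => i _; ring. Qed.

Lemma sqdistxx x : sqdist x x = 0.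
Proof. by apply: big1 => i _; rewrite subrr expr0n. Qed.

Lemma eucl_dist_cat (z z' : T.-tuple R * T.-tuple R) :
  eucl_dist [tuple of z.1 ++ z.2] [tuple of z'.1 ++ z'.2] ^+ 2 =
  sqdist z.1 z'.1 + sqdist z.2 z'.2.
Proof.
rewrite /eucl_dist sqr_sqrtr; last by apply: sumr_ge0 => i _; exact: sqr_ge0.
rewrite big_split_ord/=; congr (_ + _); apply: eq_bigr => i _.
- by rewrite !tnth_lshift.
- by rewrite !tnth_rshift.
Qed.

Lemma measurable_sqdist d (Om : measurableType d) (X Y : {mfun Om >-> T.-tuple R}) :
  measurable_fun setT (fun w => sqdist (X w) (Y w)).
Proof.
apply: measurable_sum => i; apply: measurable_funX; apply: measurable_funB.
- by apply: (measurableT_comp (measurable_tnth i)).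
- by apply: (measurableT_comp (measurable_tnth i)).
Qed.

End sqdist_theory.

Section mixed_expectations.
Context (R : realType) d (OmV : measurableType d) (PV : probability OmV R).
Variables (V : {RV PV >-> R}) (nu l : R).
Hypotheses (nu0 : 0 < nu) (l0 : 0 < l) (hV : inv_gamma_distributed nu nu V).

(* V is positive only almost surely; with its positive part all the integrands
   below are bounded by 1. *)
Definition pospart v : R := Num.max (V v) 0.

Lemma pospart_ge0 v : 0 <= pospart v.
Proof. by rewrite /pospart le_max lexx orbT. Qed.

Lemma measurable_pospart : measurable_fun setT pospart.
Proof. exact: measurable_maxr. Qed.

Lemma pospart_ae : {ae PV, forall v, pospart v = V v}.
Proof.
apply: filterS (inv_gamma_gt0 hV) => v v0.
by rewrite /pospart max_l// ltW.
Qed.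

(** The Matern function in terms of the squared distance, kept as a mixture: squared distances are
    sums over coordinates, and bounds and measurability come from the integrand. *)
Definition mixed (s2 : R) : R := \int[PV]_v expR (- (pospart v / (2 * l ^+ 2) * s2)).

Lemma mixed0 : mixed 0 = 1.
Proof.
rewrite /mixed; under eq_Rintegral do rewrite mulr0 oppr0 expR0.
exact: Rintegral_prob_cst.
Qed.

Let expo_le1 v s2 : 0 <= s2 -> `|expR (- (pospart v / (2 * l ^+ 2) * s2))| <= 1.
Proof.
move=> s0; rewrite ger0_norm ?expR_ge0// -expR0 ler_expR oppr_le0.
by rewrite mulr_ge0// divr_ge0 ?pospart_ge0// mulr_ge0// sqr_ge0.
Qed.

Let mexpo s2 : measurable_fun setT (fun v => expR (- (pospart v / (2 * l ^+ 2) * s2))).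
Proof.
apply: measurableT_comp => //; apply: measurableT_comp => //.
by apply: measurable_funM => //; apply: measurable_funM => //; exact: measurable_pospart.
Qed.

Lemma mixed_ge0_le1 s2 : 0 <= s2 -> 0 <= mixed s2 <= 1.
Proof.
move=> s0; rewrite Rintegral_ge0/=; last by move=> v _; exact: expR_ge0.
rewrite -[leRHS](Rintegral_prob_cst PV); apply: le_Rintegral => //.
- by apply: (@bounded_integrable _ _ _ _ _ 1) => // v; exact: expo_le1.
- by apply: (@bounded_integrable _ _ _ _ _ 1) => // v; rewrite normr1.
- by move=> v _; apply: le_trans (ler_norm _) (expo_le1 v s0).
Qed.

Lemma matern_kernel_mixed (T : nat) (su : R) (z z' : T.-tuple R * T.-tuple R) :
  matern_kernel su l nu z z' = su ^+ 2 * mixed (sqdist z.1 z'.1 + sqdist z.2 z'.2).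
Proof.
rewrite /matern_kernel; congr (_ * _); rewrite -eucl_dist_cat.
rewrite (matern_mixture nu0 l0 (sqrtr_ge0 _) hV) -/(eucl_dist _ _) /mixed /Rintegral; congr fine.
apply: ae_eq_integral => //.
- apply/measurable_EFinP; apply: measurableT_comp => //; apply: measurableT_comp => //.
  by apply: measurable_funM => //; exact: measurable_funM.
- exact/measurable_EFinP.
- by apply: filterS pospart_ae => v -> _.
Qed.

(** Exchanges the attribute and mixing averages, so that the attribute expectation is needed only at
    a deterministic [t >= 0]. *)
Lemma Rintegral_mixed d' (Om : measurableType d') (P : probability Om R)
    (G : Om -> R) (phi : R -> R) : measurable_fun setT G -> (forall a, 0 <= G a) ->
  (forall t, 0 <= t -> \int[P]_a expR (- (t / (2 * l ^+ 2) * G a)) = phi t) ->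
  \int[P]_a mixed (G a) = \int[PV]_v phi (pospart v).
Proof.
move=> mG G0 phiE.
rewrite /mixed (@Rfubini _ _ _ _ _ P PV
  (fun z => expR (- (pospart z.2 / (2 * l ^+ 2) * G z.1))) 1).
- by apply: eq_Rintegral => v _ /=; exact: (phiE _ (pospart_ge0 v)).
- apply: measurableT_comp => //; apply: measurableT_comp => //.
  apply: measurable_funM; last exact: measurableT_comp mG measurable_fst.
  apply: measurable_funM => //.
  exact: measurableT_comp measurable_pospart measurable_snd.
- by move=> z; exact: expo_le1.
Qed.

Lemma measurable_mixed d' (Om : measurableType d') (P : probability Om R) (G : Om -> R) :
  measurable_fun setT G -> (forall a, 0 <= G a) ->
  measurable_fun setT (fun a => mixed (G a)).
Proof.
move=> mG G0.
apply: (@measurable_Rfubini _ _ _ _ _ P PV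
  (fun z => expR (- (pospart z.2 / (2 * l ^+ 2) * G z.1))) 1).
- apply: measurableT_comp => //; apply: measurableT_comp => //.
  apply: measurable_funM; last exact: measurableT_comp mG measurable_fst.
  apply: measurable_funM => //.
  exact: measurableT_comp measurable_pospart measurable_snd.
- by move=> z; exact: expo_le1.
Qed.

(** Links expectations over [V] itself to the computations with [pospart]; [f] is controlled only on
    nonnegative arguments. *)
Lemma expectation_powR_pospart (f : R -> R) : measurable_fun setT f ->
  (forall t, 0 <= t -> `|f t| <= 1) ->
  ('E_PV[fun v => f (V v)] = (\int[PV]_v f (pospart v))%:E)%E.
Proof.
move=> mf f1; rewrite expectation.unlock /Rintegral fineK; last first.
  apply: (@integrable_fin_num _ _ _ PV setT measurableT (EFin \o (f \o pospart))).
  apply: (@bounded_integrable _ _ _ _ _ 1).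
    exact: measurableT_comp mf measurable_pospart.
  by move=> v; apply: f1; exact: pospart_ge0.
apply: ae_eq_integral => //.
- by apply/measurable_EFinP; exact: measurableT_comp.
- by apply/measurable_EFinP; exact: measurableT_comp mf measurable_pospart.
- by apply: filterS pospart_ae => v -> _.
Qed.

End mixed_expectations.

Section attribute_expectations.
Context (R : realType) d (Om : measurableType d) (P : probability Om R).
Variables (T : nat) (pi : probability (T.-tuple R) R) (sigma l : R).
Hypotheses (l0 : 0 < l) (hpi : gaussian_law pi (sigma ^+ 2)%:M).
Variables (X Y W : {RV P >-> T.-tuple R}).
Hypothesis hiid : iid_draws pi X Y W.
Let r := sigma / l.
Let e : R := - (T%:R / 2).

(** Subordination uses a normal law with nonzero deviation. At [t = 0] the expectations below are 1
    on both sides; otherwise [t] is a square. *)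
Let tau_of (t : R) : 0 <= t -> t = 0 \/ exists2 tau : R, tau != 0 & tau ^+ 2 = t.
Proof.
rewrite le_eqVlt => /predU1P[<-|t0]; [by left|right].
by exists (Num.sqrt t); rewrite ?sqr_sqrtr ?gt_eqF ?sqrtr_gt0 ?ltW.
Qed.

Let zero_case (G : Om -> R) : \int[P]_a expR (- (0 / (2 * l ^+ 2) * G a)) = 1.
Proof.
under eq_Rintegral do rewrite !mul0r oppr0 expR0.
exact: Rintegral_prob_cst.
Qed.

Let taul tau : tau != 0 -> tau / l != 0.
Proof. by move=> tau0; rewrite mulf_neq0// invr_eq0 gt_eqF. Qed.

Let tau2l tau : tau != 0 -> Num.sqrt 2 * tau / l != 0.
Proof. by move=> tau0; apply: taul; rewrite mulf_neq0// gt_eqF// sqrtr_gt0. Qed.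

Lemma expectation_sqdist_YW (t : R) : 0 <= t ->
  \int[P]_a expR (- (t / (2 * l ^+ 2) * sqdist (Y a) (W a))) =
  (1 + 2 * r ^+ 2 * t) `^ e.
Proof.
move=> t0; have [->|[tau tau0 tauE]] := tau_of t0.
  by rewrite zero_case mulr0 addr0 powR1.
rewrite (_ : 1 + 2 * r ^+ 2 * t = 1 + 2 * sigma ^+ 2 * (tau / l) ^+ 2); last first.
  by rewrite /r -tauE; field; rewrite gt_eqF.
have -> : t / (2 * l ^+ 2) = (tau / l) ^+ 2 / 2 by rewrite -tauE; field; rewrite gt_eqF.
exact: (expectation_gauss_YW hpi hiid (taul tau0)).
Qed.

Lemma expectation_sqdist_XY (t : R) : 0 <= t ->
  \int[P]_a expR (- (t / (2 * l ^+ 2) * (2 * sqdist (X a) (Y a)))) =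
  (1 + 4 * r ^+ 2 * t) `^ e.
Proof.
move=> t0; have [->|[tau tau0 tauE]] := tau_of t0.
  by rewrite zero_case mulr0 addr0 powR1.
(* The factor 2 before the squared distance is absorbed into the frequency scale, turning 2 r^2 into
   4 r^2. *)
have s2 : (Num.sqrt 2 * tau / l) ^+ 2 = 2 * t / l ^+ 2.
  by rewrite expr_div_n exprMn sqr_sqrtr// tauE.
rewrite (_ : 1 + 4 * r ^+ 2 * t = 1 + 2 * sigma ^+ 2 * (Num.sqrt 2 * tau / l) ^+ 2); last first.
  by rewrite s2 /r; field; rewrite gt_eqF.
have tE : t / (2 * l ^+ 2) * 2 = (Num.sqrt 2 * tau / l) ^+ 2 / 2.
  by rewrite s2; field; rewrite gt_eqF.
under eq_Rintegral do rewrite mulrA tE.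
exact: (expectation_gauss_XY hpi hiid (tau2l tau0)).
Qed.

Lemma expectation_sqdist_XWYX (t : R) : 0 <= t ->
  \int[P]_a expR (- (t / (2 * l ^+ 2) * (sqdist (X a) (W a) + sqdist (Y a) (X a)))) =
  (1 + r ^+ 2 * t) `^ e * (1 + 3 * r ^+ 2 * t) `^ e.
Proof.
move=> t0; have [->|[tau tau0 tauE]] := tau_of t0.
  by rewrite zero_case !mulr0 !addr0 powR1 mulr1.
rewrite (_ : 1 + r ^+ 2 * t = 1 + sigma ^+ 2 * (tau / l) ^+ 2); last first.
  by rewrite /r -tauE; field; rewrite gt_eqF.
rewrite (_ : 1 + 3 * r ^+ 2 * t = 1 + 3 * sigma ^+ 2 * (tau / l) ^+ 2); last first.
  by rewrite /r -tauE; field; rewrite gt_eqF.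
have -> : t / (2 * l ^+ 2) = (tau / l) ^+ 2 / 2 by rewrite -tauE; field; rewrite gt_eqF.
under eq_Rintegral do rewrite /sqdist -big_split.
exact: (expectation_gauss_XWYX hpi hiid (taul tau0)).
Qed.

End attribute_expectations.

Lemma powR_le1_norm (R : realType) (p k t : R) : 0 <= p -> 0 <= k -> 0 <= t ->
  0 <= (1 + k * t) `^ (- p) <= 1.
Proof.
move=> p0 k0 t0; rewrite powR_ge0/= -[leRHS](powRr0 (1 + k * t)).
by apply: ler_powR; rewrite ?oppr_le0// lerDl mulr_ge0.
Qed.

Lemma measurable_affine_powR (R : realType) (p k : R) :
  measurable_fun setT (fun t : R => (1 + k * t) `^ p).
Proof.
apply: (@measurableT_comp _ _ _ _ _ _ (fun x : R => x `^ p)); first exact: measurable_powR.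
by apply: measurable_funD => //; exact: measurable_funM.
Qed.

(* For y = 0 both inverses are +oo and the identity persists. *)
Lemma divee_pmul2l (R : realType) (k x y : R) : 0 < k ->
  (((k * y)%:E)^-1 * (k * x)%:E = x%:E / y%:E)%E.
Proof.
move=> k0; have [->|y0] := eqVneq y 0.
  by rewrite mulr0 !inve0 [LHS]muleC EFinM muleAC gt0_muley ?lte_fin// muleC.
rewrite !inver mulf_eq0 (gt_eqF k0) (negbTE y0)/= -!EFinM; congr EFin.
by field; rewrite y0 gt_eqF.
Qed.

(** * Moments of F and its conditional means given F *)

Section skew_process.
Context (R : realType) (T : nat) (nu l su : R).
Hypotheses (nu0 : 0 < nu) (l0 : 0 < l).
Context d (Om : measurableType d) (PF : probability Om R).
Variable U : T.-tuple R * T.-tuple R -> Om -> R.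
Hypothesis hUmeas : measurable_fun setT
  (fun p : Om * (T.-tuple R * T.-tuple R) => U p.2 p.1).
Hypothesis hUcov : forall z z' : T.-tuple R * T.-tuple R,
  covariance PF (U z) (U z') = (matern_kernel su l nu z z')%:E.
Hypothesis hFmean : forall x y : T.-tuple R, ('E_PF[skew_part U x y] = 0)%E.
Context dV (OmV : measurableType dV) (PV : probability OmV R) (V : {RV PV >-> R}).
Hypothesis hV : inv_gamma_distributed nu nu V.
Notation h := (mixed V l).

Let mU z : measurable_fun setT (U z).
Proof. exact: measurableT_comp hUmeas (pair2_measurable z). Qed.

(** Two of the four kernel values are at distance 0; the other two compare (x, y) with (y, x), at
    squared distance 2|x - y|^2. *)
Lemma skew_variance x y :
  (\int[PF]_w (skew_part U x y w * skew_part U x y w)%:E =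
   (2 * su ^+ 2 * (1 - h (2 * sqdist x y)))%:E)%E.
Proof.
rewrite (skew_part_moment mU hUcov hFmean) !(matern_kernel_mixed nu0 l0 hV)/=.
rewrite !sqdistxx (sqdistC y x) addr0 mixed0 -mulr2n -[sqdist x y *+ 2]mulr_natl.
by congr EFin; ring.
Qed.

(** The aligned pairs share the endpoint [x] and leave |y - w'|^2; the crossed pairs give |x - w'|^2
    + |y - x|^2. Each value occurs twice. *)
Lemma skew_covariance x y w' :
  (\int[PF]_w (skew_part U x y w * skew_part U x w' w)%:E =
   (2 * su ^+ 2 * (h (sqdist y w') - h (sqdist x w' + sqdist y x)))%:E)%E.
Proof.
rewrite (skew_part_moment mU hUcov hFmean) !(matern_kernel_mixed nu0 l0 hV)/=.
rewrite !sqdistxx addr0 add0r (addrC (sqdist y x)).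
by congr EFin; ring.
Qed.

Context d' (Om' : measurableType d') (PX : probability Om' R).
Variables (pi : probability (T.-tuple R) R).

Section pair.
Variables (X Y : {RV PX >-> T.-tuple R}).
Hypothesis XY : forall A B : set (T.-tuple R), measurable A -> measurable B ->
  PX ((X @^-1` A) `&` (Y @^-1` B)) = (pi A * pi B)%E.

Definition skew_pair (z : Om' * Om) := skew_part U (X z.1) (Y z.1) z.2.

Lemma measurable_skew_pair : measurable_fun setT skew_pair.
Proof.
have mXz (Z : {RV PX >-> T.-tuple R}) : measurable_fun setT (fun z : Om' * Om => Z z.1).
  exact: measurableT_comp.
apply: measurable_funB.
- apply: (measurableT_comp (f := fun p : Om * (T.-tuple R * T.-tuple R) => U p.2 p.1)
    (g := fun z : Om' * Om => (z.2, (X z.1, Y z.1)))) => //.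
  by apply: measurable_fun_pair => //; exact: measurable_fun_pair.
- apply: (measurableT_comp (f := fun p : Om * (T.-tuple R * T.-tuple R) => U p.2 p.1)
    (g := fun z : Om' * Om => (z.2, (Y z.1, X z.1)))) => //.
  by apply: measurable_fun_pair => //; exact: measurable_fun_pair.
Qed.

(** By Tonelli, with F integrated first: for fixed attributes the second moment is explicit and at
    most 2 su^2, since [mixed] is nonnegative. *)
Lemma integrable_skew_pair_sqr :
  (PX \x PF)%E.-integrable setT (EFin \o (fun z => skew_pair z ^+ 2)).
Proof.
apply/integrable12ltyP; first by apply/measurable_EFinP; apply: measurable_funX; exact: measurable_skew_pair.
apply: (@le_lt_trans _ _ (\int[PX]_a (2 * su ^+ 2)%:E)%E); last first.
  by rewrite integral_cst//= probability_setT mule1 ltry.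
apply: ge0_le_integral => //.
- by move=> a _; apply: integral_ge0.
- apply: (@measurable_fun_fubini_tonelli_F _ _ _ _ _ PF (fun z => `|(skew_pair z ^+ 2)%:E|%E)) => //.
  apply: measurableT_comp => //.
  by apply/measurable_EFinP; apply: measurable_funX; exact: measurable_skew_pair.
move=> a _; under eq_integral do rewrite /= ger0_norm ?sqr_ge0// expr2 /skew_pair/=.
have s2 : 0 <= 2 * su ^+ 2 by rewrite mulr_ge0// sqr_ge0.
rewrite skew_variance lee_fin ler_piMr//.
have /(mixed_ge0_le1 V l)/andP[] : 0 <= 2 * sqdist (X a) (Y a) by rewrite mulr_ge0// sqdist_ge0.
by move=> h0 _; rewrite lerBlDr lerDl.
Qed.

(** The exchange of endpoints requires the section at [w] to be integrable, which square
    integrability on the product provides for almost every [w]. *)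
Lemma ae_skew_pair_mean : {ae PF, forall w, \int[PX]_a skew_pair (a, w) = 0}.
Proof.
apply: filterS (ae_integrable2 integrable_skew_pair_sqr) => w /= iw.
pose f (z : T.-tuple R * T.-tuple R) := skew_part U z.1 z.2 w.
have mf : measurable_fun setT f.
  have m1 := measurableT_comp hUmeas (pair1_measurable w).
  apply: measurable_funB; first by apply: eq_measurable_fun m1 => -[x y] _.
  apply: (measurableT_comp (f := fun z => U z w) (g := fun z => (z.2, z.1))) => //.
  exact: measurable_fun_pair.
apply: (exchangeable_skew_mean XY mf).
- by move=> x y; rewrite /f /skew_part/= opprB.
- apply: integrable_of_sqr => //.
  by apply: (measurableT_comp mf); exact: measurable_fun_pair.
Qed.

End pair.

End skew_process.

Theorem mainTheorem9 (R : realType) (T : nat) (nu l sigma_u sigma_x : R)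
    (hT : (1 <= T)%N) (hnu : 0 < nu) (hl : 0 < l)
    (hsu : 0 < sigma_u) (hsx : 0 < sigma_x)
    (d : measure_display) (Om : measurableType d) (PF : probability Om R)
    (U : T.-tuple R * T.-tuple R -> Om -> R)
    (hUmeas : measurable_fun setT
       (fun p : Om * (T.-tuple R * T.-tuple R) => U p.2 p.1))
    (hUgauss : gaussian_process PF U)
    (hUcov : forall z z' : T.-tuple R * T.-tuple R,
       covariance PF (U z) (U z') = (matern_kernel sigma_u l nu z z')%:E)
    (hFmean : forall x y : T.-tuple R, ('E_PF[skew_part U x y] = 0)%E)
    (d' : measure_display) (Om' : measurableType d') (PX : probability Om' R)
    (pi_X : probability (T.-tuple R) R)
    (hpi : gaussian_law pi_X (sigma_x ^+ 2)%:M)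
    (X Y W : {RV PX >-> T.-tuple R})
    (hiid : iid_draws pi_X X Y W)
    (dV : measure_display) (OmV : measurableType dV) (PV : probability OmV R)
    (V : {RV PV >-> R})
    (hV : inv_gamma_distributed nu nu V) :
  let r : R := sigma_x / l in
  let e : R := - (T%:R / 2) in
  (shared_endpoint_correlation PF PX (skew_part U) X Y W =
   ('E_PV[(fun v => (1 + 2 * r ^+ 2 * V v) `^ e)%R]
    - 'E_PV[(fun v => (1 + r ^+ 2 * V v) `^ e * (1 + 3 * r ^+ 2 * V v) `^ e)%R])
   / (1 - 'E_PV[(fun v => (1 + 4 * r ^+ 2 * V v) `^ e)%R]))%E.
Proof.
move=> r e.
pose C4 := \int[PV]_v (1 + 4 * r ^+ 2 * pospart V v) `^ e.
pose C2 := \int[PV]_v (1 + 2 * r ^+ 2 * pospart V v) `^ e.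
pose C13 := \int[PV]_v ((1 + r ^+ 2 * pospart V v) `^ e * (1 + 3 * r ^+ 2 * pospart V v) `^ e).
have T0 : 0 <= T%:R / 2 :> R by rewrite divr_ge0.
have rr : 0 <= r ^+ 2 by exact: sqr_ge0.
have le1 (k t : R) : 0 <= k -> 0 <= t -> 0 <= (1 + k * t) `^ e <= 1.
  exact: powR_le1_norm.
have E4 : ('E_PV[(fun v => (1 + 4 * r ^+ 2 * V v) `^ e)%R] = C4%:E)%E.
  apply: (expectation_powR_pospart hV (f := fun t => (1 + 4 * r ^+ 2 * t) `^ e)).
    exact: measurable_affine_powR.
  by move=> t t0; have /andP[? ?] := le1 (4 * r ^+ 2) t (mulr_ge0 (ler0n _ 4) rr) t0; rewrite ger0_norm.
have E2 : ('E_PV[(fun v => (1 + 2 * r ^+ 2 * V v) `^ e)%R] = C2%:E)%E.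
  apply: (expectation_powR_pospart hV (f := fun t => (1 + 2 * r ^+ 2 * t) `^ e)).
    exact: measurable_affine_powR.
  by move=> t t0; have /andP[? ?] := le1 (2 * r ^+ 2) t (mulr_ge0 (ler0n _ 2) rr) t0; rewrite ger0_norm.
have E13 : ('E_PV[(fun v => (1 + r ^+ 2 * V v) `^ e * (1 + 3 * r ^+ 2 * V v) `^ e)%R] = C13%:E)%E.
  apply: (expectation_powR_pospart hV
    (f := fun t => (1 + r ^+ 2 * t) `^ e * (1 + 3 * r ^+ 2 * t) `^ e)).
    by apply: measurable_funM; exact: measurable_affine_powR.
  move=> t t0; have /andP[h1 h2] := le1 (r ^+ 2) t rr t0.
  have /andP[h3 h4] := le1 (3 * r ^+ 2) t (mulr_ge0 (ler0n _ 3) rr) t0.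
  by rewrite ger0_norm ?mulr_ge0// mulr_ile1.
have lX A : measurable A -> PX (X @^-1` A) = pi_X A by move=> mA; case: (hiid.1 A mA).
have lY A : measurable A -> PX (Y @^-1` A) = pi_X A by move=> mA; case: (hiid.1 A mA).
have lW A : measurable A -> PX (W @^-1` A) = pi_X A by move=> mA; case: (hiid.1 A mA).
have XY A B : measurable A -> measurable B ->
    PX ((X @^-1` A) `&` (Y @^-1` B)) = (pi_X A * pi_X B)%E.
  move=> mA mB; rewrite -lX// -lY//; have := hiid.2 A B setT mA mB measurableT.
  by rewrite preimage_setT setIT probability_setT mule1.
have XW A B : measurable A -> measurable B ->
    PX ((X @^-1` A) `&` (W @^-1` B)) = (pi_X A * pi_X B)%E.
  move=> mA mB; rewrite -lX// -lW//; have := hiid.2 A setT B mA measurableT mB.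
  by rewrite preimage_setT setIT probability_setT mule1.
pose k := 2 * sigma_u ^+ 2.
have k0 : 0 < k by rewrite mulr_gt0// exprn_gt0.
have ih (G : Om' -> R) : measurable_fun setT G -> (forall a, 0 <= G a) ->
    PX.-integrable setT (EFin \o (fun a => mixed V l (G a))).
  move=> mG G0; apply: (@bounded_integrable _ _ _ _ _ 1); first exact: measurable_mixed.
  by move=> a; have /andP[? ?] := mixed_ge0_le1 V l (G0 a); rewrite ger0_norm.
have mXY := measurable_sqdist X Y.
have mYX := measurable_sqdist Y X.
have mYW := measurable_sqdist Y W.
have mXW := measurable_sqdist X W.
have mM := measurable_skew_pair hUmeas X Y.
have mN := measurable_skew_pair hUmeas X W.
have M2 := integrable_skew_pair_sqr hnu hl hUmeas hUcov hFmean hV (PX := PX) X Y.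
have N2 := integrable_skew_pair_sqr hnu hl hUmeas hUcov hFmean hV (PX := PX) X W.
have M0 := ae_skew_pair_mean hnu hl hUmeas hUcov hFmean hV XY.
have N0 := ae_skew_pair_mean hnu hl hUmeas hUcov hFmean hV XW.
have varE : total_variance PF PX (skew_part U) X Y = (k * (1 - C4))%:E.
  transitivity (\int[PX]_a (k * (1 - mixed V l (2 * sqdist (X a) (Y a))))%:E)%E.
    (* A variance is the covariance of a function with itself, so [integral_covariance] serves the
       denominator as well as the numerator. *)
    rewrite -[LHS]/(\int[PF]_w covariance PX (fun a => skew_pair U X Y (a, w))
      (fun a => skew_pair U X Y (a, w)))%E.
    rewrite (integral_covariance mM mM M2 M2 M0 M0).
    by apply: eq_integral => a _; exact: (skew_variance hnu hl hUmeas hUcov hFmean hV (X a) (Y a)).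
  have mG : measurable_fun setT (fun a => 2 * sqdist (X a) (Y a)) by apply: measurable_funM.
  have G0 a : 0 <= 2 * sqdist (X a) (Y a) by rewrite mulr_ge0// sqdist_ge0.
  have i1 : PX.-integrable setT (EFin \o (fun=> 1 : R)).
    by apply: (@bounded_integrable _ _ _ _ _ 1) => // a; rewrite normr1.
  have i2 : PX.-integrable setT (EFin \o (fun a => 1 - mixed V l (2 * sqdist (X a) (Y a)))).
    exact: eq_integrable (integrableB measurableT i1 (ih _ mG G0)).
  rewrite EFin_Rintegral; last exact: eq_integrable (integrableZl measurableT k i2).
  rewrite RintegralZl// RintegralB//; last exact: ih.
  rewrite Rintegral_prob_cst (Rintegral_mixed V mG G0 (phi := fun t => (1 + 4 * r ^+ 2 * t) `^ e))//.
  exact: (expectation_sqdist_XY hl hpi hiid).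
have covE : (\int[PF]_w covariance PX (fun a => skew_part U (X a) (Y a) w)
    (fun a => skew_part U (X a) (W a) w))%E = (k * (C2 - C13))%:E.
  transitivity (\int[PX]_a (k * (mixed V l (sqdist (Y a) (W a)) -
      mixed V l (sqdist (X a) (W a) + sqdist (Y a) (X a))))%:E)%E.
    rewrite -[LHS]/(\int[PF]_w covariance PX (fun a => skew_pair U X Y (a, w))
      (fun a => skew_pair U X W (a, w)))%E.
    rewrite (integral_covariance mM mN M2 N2 M0 N0).
    by apply: eq_integral => a _; exact: (skew_covariance hnu hl hUmeas hUcov hFmean hV (X a) (Y a) (W a)).
  have mG : measurable_fun setT (fun a => sqdist (X a) (W a) + sqdist (Y a) (X a)).
    exact: measurable_funD.
  have G0 a : 0 <= sqdist (X a) (W a) + sqdist (Y a) (X a) by rewrite addr_ge0 ?sqdist_ge0.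
  have D0 a : 0 <= sqdist (Y a) (W a) by exact: sqdist_ge0.
  have i2 : PX.-integrable setT (EFin \o (fun a => mixed V l (sqdist (Y a) (W a)) -
      mixed V l (sqdist (X a) (W a) + sqdist (Y a) (X a)))).
    exact: eq_integrable (integrableB measurableT (ih _ mYW D0) (ih _ mG G0)).
  rewrite EFin_Rintegral; last exact: eq_integrable (integrableZl measurableT k i2).
  rewrite RintegralZl// RintegralB//; [|exact: ih|exact: ih].
  rewrite (Rintegral_mixed V mYW D0 (phi := fun t => (1 + 2 * r ^+ 2 * t) `^ e)); last first.
    exact: (expectation_sqdist_YW hl hpi hiid).
  rewrite (Rintegral_mixed V mG G0
    (phi := fun t => (1 + r ^+ 2 * t) `^ e * (1 + 3 * r ^+ 2 * t) `^ e))//.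
  exact: (expectation_sqdist_XWYX hl hpi hiid).
rewrite /shared_endpoint_correlation varE covE E4 E2 E13.
(* The common factor [k] is positive and cancels, so [sigma_u] disappears from the correlation. *)
by rewrite divee_pmul2l// !EFinB.
Qed.
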